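(* There is a quantum algorithm and a universal constant $K$ with the following properties. Given $\varepsilon>0$ and ''the code'' for a $[0,1]$-bounded real random variable $\boldsymbol{y}$ with mean $\mu=\mathbb{E}[\boldsymbol{y}]>0$ and standard deviation $\sigma=\sqrt{\mathbb{E}[(\boldsymbol{y}-\mu)^2]}$ (with $\mu$ and $\sigma$ unknown to the algorithm), the algorithm has the following behavior except with probability at most $1/3$: it obtains at most $$K\cdot\max\left\{\frac{\sigma}{\varepsilon\mu},\ \frac{1}{\sqrt{\varepsilon\mu}}\right\}$$ samples (uses of the code for $\boldsymbol{y}$; this number depends on the unknown $\mu$), and outputs an estimate $\widehat{\boldsymbol{\mu}}$ such that $$(1-\varepsilon)\mu\le\widehat{\boldsymbol{\mu}}\le(1+\varepsilon)\mu.$$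
   Context: Random variables. A finite probability space is a pair $(\Omega,p)$ with $\Omega$ finite and $p:\Omega\to[0,1]$, $\sum_\omega p(\omega)=1$. A random variable $\boldsymbol{y}$ on it is a function $y:\Omega\to\mathbb{R}$; it is $[0,1]$-bounded if $y(\omega)\in[0,1]$ for all $\omega$; $\mathbb{E}[\boldsymbol{y}]=\sum_{\omega}p(\omega)y(\omega)$. Synthesizer. A synthesizer for $p$ is a unitary circuit $\mathcal{P}$ with $\mathcal{P}|\vec 0\rangle=\sum_{\omega\in\Omega}\sqrt{p(\omega)}\,|\omega\rangle|\mathrm{garbage}_\omega\rangle$, where $|\vec 0\rangle$ is a fixed easy-to-prepare state (e.g. $|0^k\rangle$), $|\omega\rangle$ is the (orthonormal, computational basis) encoding of $\omega$, and each $|\mathrm{garbage}_\omega\rangle$ is an arbitrary unit vector. Having the code for $\boldsymbol{y}$. This means having black-box access to controlled-$\mathcal{P}$ and controlled-$\mathcal{P}^\dagger$ for some synthesizer $\mathcal{P}$ for $p$, and to controlled-$\mathcal{Y}$ and controlled-$\mathcal{Y}^\dagger$ for some unitary circuit $\mathcal{Y}$ with $\mathcal{Y}|\omega\rangle|0^b\rangle|0^c\rangle=|\omega\rangle|y(\omega)\rangle|0^c\rangle$ for all $\omega\in\Omega$, where the real values of $y$ are encoded with $b$ bits and the $c$ extra bits are ancillas. Each application of one of these four black boxes is one use of the code (one ''sample'' or ''query''); operations not involving the black boxes are not counted. The algorithm may stop adaptively. The algorithm and the constant are universal: they do not depend on $(\Omega,p)$, $y$, $\mathcal{P}$, $\mathcal{Y}$,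 $\varepsilon$. *)

(* Defs.v *)
From HB Require Import structures.
From mathcomp Require Import all_boot all_order all_algebra.
From mathcomp Require Import reals.
From mathcomp Require Import complex mxtens sesquilinear spectral.

Set Implicit Arguments.
Unset Strict Implicit.
Unset Printing Implicit Defensive.
Import Order.TTheory GRing.Theory Num.Theory.
Local Open Scope ring_scope.
Local Open Scope sesquilinear_scope.

Definition is_distr (R : realType) (Omega : finType) (p : Omega -> R) : Prop :=
  (forall w, 0 <= p w <= 1) /\ \sum_w p w = 1.

Definition expectation (R : realType) (Omega : finType) (p y : Omega -> R) : R :=
  \sum_w p w * y w.

Definition stddev (R : realType) (Omega : finType) (p y : Omega -> R) : R :=
  Num.sqrt (expectation p (fun w => (y w - expectation p y) ^+ 2)).

(* A state of an n-dimensional register is a column vector; the joint state of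
   two registers lives in dimension m * n, through the Kronecker product [*t].
   The computational basis of a register of k qubits is indexed by 'I_(2 ^ k),
   a k-bit string being read in binary. *)

Definition sqnorm (R : realType) n (v : 'cV[R[i]]_n) : R :=
  \sum_i (Normc.normc (v i 0)) ^+ 2.

Definition ket (R : realType) n (i : 'I_n) : 'cV[R[i]]_n := delta_mx i 0.

Definition zero_bits k : 'I_(2 ^ k) := Ordinal (expn_gt0 2 k).

Definition tens_state (R : realType) m n (u : 'cV[R[i]]_m) (v : 'cV[R[i]]_n) :
  'cV[R[i]]_(m * n) := u *t v.

Definition controlled (R : realType) d (U : 'M[R[i]]_d) : 'M[R[i]]_(2 * d) :=
  delta_mx 0 0 *t 1%:M + delta_mx 1 1 *t U.

(* The register of a qubits holds the encoding [enc w] of the sample point w,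
   the register of g qubits holds the garbage. *)
Definition synthesizer (R : realType) (Omega : finType) (p : Omega -> R) (a g : nat)
    (enc : Omega -> 'I_(2 ^ a)) (init : 'cV[R[i]]_(2 ^ a * 2 ^ g))
    (P : 'M[R[i]]_(2 ^ a * 2 ^ g)) : Prop :=
  P \is unitarymx /\
  exists garbage : Omega -> 'cV[R[i]]_(2 ^ g),
    (forall w, sqnorm (garbage w) = 1) /\
    P *m init =
      \sum_w (Num.sqrt (p w))%:C%C *: tens_state (ket R (enc w)) (garbage w).

(* [val_enc r] is the b-bit string representing the real number r. *)
Definition evaluator (R : realType) (Omega : finType) (y : Omega -> R) (a b c : nat)
    (enc : Omega -> 'I_(2 ^ a)) (val_enc : R -> 'I_(2 ^ b))
    (Y : 'M[R[i]]_(2 ^ a * 2 ^ b * 2 ^ c)) : Prop :=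
  Y \is unitarymx /\
  forall w,
    Y *m tens_state (tens_state (ket R (enc w)) (ket R (zero_bits b)))
                    (ket R (zero_bits c)) =
    tens_state (tens_state (ket R (enc w)) (ket R (val_enc (y w))))
               (ket R (zero_bits c)).

Inductive box := BoxP | BoxPdag | BoxY | BoxYdag.

Definition box_dim (dP dY : nat) (x : box) : nat :=
  match x with BoxP | BoxPdag => 2 * dP | BoxY | BoxYdag => 2 * dY end.

Definition box_op (R : realType) dP dY (P : 'M[R[i]]_dP) (Y : 'M[R[i]]_dY) (x : box) :
    'M[R[i]]_(box_dim dP dY x) :=
  match x with
  | BoxP => controlled P
  | BoxPdag => controlled (P ^t*)
  | BoxY => controlled Y
  | BoxYdag => controlled (Y ^t*)
  end.

(* Adaptive quantum query algorithms, with black boxes known only through the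
   dimensions dP and dY they act on.  [process n] is an algorithm holding an
   n-dimensional quantum register.  It performs a general quantum measurement,
   with finitely many outcomes and measurement operators M i; these may change
   the dimension of the register, so that unitaries, the introduction of
   ancillas and the reset or discarding of registers are all special cases.
   Depending on the outcome, it then either stops with a real output, or
   applies one black box, leaving a w-dimensional workspace untouched, and
   goes on.  The type is coinductive because no bound on the number of
   queries is imposed beforehand. *)

CoInductive process (R : realType) (dP dY : nat) : nat -> Type :=
| Measure (n : nat) (J : finType) (dim : J -> nat)
    (M : forall i, 'M[R[i]]_(dim i, n))
    (_ : \sum_i (M i) ^t* *m M i = 1%:M)
    (next : forall i, action R dP dY (dim i)) : process R dP dY n
with action (R : realType) (dP dY : nat) : nat -> Type :=
| Output (n : nat) (r : R) : action R dP dY n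
| Query (x : box) (w : nat)
    (next : process R dP dY (box_dim dP dY x * w)) :
    action R dP dY (box_dim dP dY x * w).

(* [prob P Y good N A psi] is the probability that A, run with the boxes of P
   and Y from the register state psi, stops after at most N queries with an
   output satisfying [good].  States are left unnormalized after measurements:
   their squared norm carries the probability of the outcomes observed so far
   (Born rule). *)
Fixpoint prob (R : realType) dP dY (P : 'M[R[i]]_dP) (Y : 'M[R[i]]_dY)
    (good : pred R) (N : nat) n (A : process R dP dY n) : 'cV[R[i]]_n -> R :=
  match A in process _ _ _ n return 'cV[R[i]]_n -> R with
  | Measure _ J dim M _ next => fun psi =>
    \sum_(i : J)
      match next i in action _ _ _ m return 'cV[R[i]]_m -> R with
      | Output _ r => fun phi => if good r then sqnorm phi else 0
      | Query x w A' => fun phi =>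
        if N is N'.+1
        then prob P Y good N' A' ((box_op P Y x *t (1%:M : 'M_w)) *m phi)
        else 0
      end (M i *m psi)
  end.

(* A uniform family of algorithms, starting from a trivial one-dimensional
   register.  Its inputs are the accuracy eps, the sizes of the registers of
   the two circuits, the easy-to-prepare state fed to the synthesizer, and the
   convention [val_dec] by which b-bit strings represent real numbers. *)
Definition algorithm (R : realType) : Type :=
  forall (eps : R) (a g b c : nat) (init : 'cV[R[i]]_(2 ^ a * 2 ^ g))
    (val_dec : 'I_(2 ^ b) -> R),
  process R (2 ^ a * 2 ^ g) (2 ^ a * 2 ^ b * 2 ^ c) 1.

(* Main.v *)
(* Let psi be the state prepared by the synthesizer, z = h(y) a function of the
   random variable, D the diagonal phase (1 + i z) / (1 - i z), computed with two
   uses of Y, and U = (2 psi psi^* - 1) D.  With m = E[z] and v = (1 - i z) psi,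
   U v = v + 2 i m psi, |v|^2 = 1 + E[z^2] and Re <v, psi> = 1.  Hence the average
   B = N^-1 sum_(k < N) U^k satisfies m^2 N^2 |B psi|^2 <= |v|^2 and, when
   N |m| <= 1, (1 - N |m|)^2 <= |v|^2 |B psi|^2: the probability |B psi|^2
   tells |m| << 1/N from |m| >> 1/N using O(N) samples.  For N = 2^J,
   B = prod_(j < J) (1 + U^(2^j)) / 2 is implemented by J Hadamard tests.
   Applied to z = 2^j x with N = 2^j for j = 0, 1, ... until the first rejection,
   this test finds E[x] up to a constant factor for x in [0, 1], without repetition
   because the rejection probability is O(4^j E[x]).  Applied to
   z = (y - s) / (16 t), t >= sigma, with s on finer and finer grids, it locates mu
   within t / 2^L using O(2^L) samples; majority votes that get shorter at finer
   levels avoid a logarithmic factor.  One alternates: find mu up to a constant,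
   locate s with |mu - s| <= sqrt(eps mu), find E[(y - s)^2] + eps mu up to a
   constant, and locate mu within eps mu with the resulting bound t on sigma. *)
From HB Require Import structures.
From mathcomp Require Import all_boot all_order all_algebra.
From mathcomp Require Import reals.
From mathcomp Require Import complex mxtens sesquilinear spectral.
From mathcomp Require Import ring lra zify.
Require Import Defs.
Set Implicit Arguments.
Unset Strict Implicit.
Unset Printing Implicit Defensive.
Import Order.TTheory GRing.Theory Num.Theory.
Local Open Scope ring_scope.
Local Open Scope sesquilinear_scope.

(** * Adjoints, isometries and tensor products *)

Section Adjoint.
Variable R : realType.
Local Notation C := R[i].

Lemma adjM m n p (A : 'M[C]_(m, n)) (B : 'M[C]_(n, p)) :
  (A *m B)^t* = B^t* *m A^t*.
Proof. by rewrite trmx_mul map_mxM. Qed.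

Lemma adjD m n (A B : 'M[C]_(m, n)) : (A + B)^t* = A^t* + B^t*.
Proof. by rewrite linearD /= map_mxD. Qed.

Lemma adjB m n (A B : 'M[C]_(m, n)) : (A - B)^t* = A^t* - B^t*.
Proof. by rewrite linearB /= map_mxB. Qed.

Lemma adjZ m n c (A : 'M[C]_(m, n)) : (c *: A)^t* = c^* *: A^t*.
Proof. by rewrite linearZ /= map_mxZ. Qed.

Lemma adjK m n (A : 'M[C]_(m, n)) : A^t*^t* = A.
Proof. exact: trmxCK. Qed.

Lemma adj1 n : (1%:M : 'M[C]_n)^t* = 1%:M.
Proof. by rewrite trmx1 map_mx1. Qed.

Lemma adj_tens m n p q (A : 'M[C]_(m, n)) (B : 'M[C]_(p, q)) :
  (A *t B)^t* = A^t* *t B^t*.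
Proof. by rewrite trmx_tens map_mxT. Qed.

Lemma adj_delta m n (i : 'I_m) (j : 'I_n) :
  (delta_mx i j : 'M[C]_(m, n))^t* = delta_mx j i.
Proof. by rewrite trmx_delta map_delta_mx. Qed.

Lemma tens11 m n : (1%:M : 'M[C]_m) *t (1%:M : 'M[C]_n) = 1%:M.
Proof.
apply/matrixP => i j.
case: (mxtens_indexP i) => i0 i1; case: (mxtens_indexP j) => j0 j1.
rewrite tensmxE !mxE (can_eq (@mxtens_indexK _ _)) xpair_eqE -natrM mulnb.
by [].
Qed.

Lemma conjCc (z : C) : (z^* = conjc z)%R.
Proof. by []. Qed.

(** The real part of the Hermitian product is the inner product of the underlying real Euclidean
    space; the estimates below need nothing more and stay in [R]. *)
Definition rdot n (u v : 'cV[C]_n) : R := complex.Re ((u^t* *m v) 0 0).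

Lemma rdotE n (u v : 'cV[C]_n) :
  rdot u v = \sum_i (complex.Re (u i 0) * complex.Re (v i 0) +
                     complex.Im (u i 0) * complex.Im (v i 0)).
Proof.
rewrite /rdot mxE raddf_sum; apply: eq_bigr => i _.
rewrite !mxE conjCc; case: (u i 0) => a b; case: (v i 0) => c d /=; ring.
Qed.

Lemma sqnormE n (u : 'cV[C]_n) : sqnorm u = rdot u u.
Proof.
rewrite rdotE /sqnorm; apply: eq_bigr => i _.
case: (u i 0) => a b /=; rewrite sqr_sqrtr ?addr_ge0 ?sqr_ge0 //.
Qed.

Lemma sqnorm_ge0 n (u : 'cV[C]_n) : 0 <= sqnorm u.
Proof. by apply: sumr_ge0 => i _; rewrite sqr_ge0. Qed.

Lemma adj_self n (u : 'cV[C]_n) : u^t* *m u = (sqnorm u)%:C%C%:M.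
Proof.
rewrite [LHS]mx11_scalar; congr (_%:M); rewrite sqnormE /rdot.
rewrite mxE /= !raddf_sum; apply: eq_bigr => i _.
rewrite !mxE conjCc; case: (u i 0) => a b /=; simpc.
by congr (_ +i* _)%C; ring.
Qed.

Lemma rdotC n (u v : 'cV[C]_n) : rdot u v = rdot v u.
Proof. by rewrite !rdotE; apply: eq_bigr => i _; ring. Qed.

Lemma rdotDr n (u v w : 'cV[C]_n) : rdot u (v + w) = rdot u v + rdot u w.
Proof. by rewrite /rdot mulmxDr mxE raddfD. Qed.

Lemma rdotDl n (u v w : 'cV[C]_n) : rdot (v + w) u = rdot v u + rdot w u.
Proof. by rewrite !(rdotC _ u) rdotDr. Qed.

Lemma rdotNr n (u v : 'cV[C]_n) : rdot u (- v) = - rdot u v.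
Proof. by rewrite /rdot mulmxN mxE raddfN. Qed.

Lemma rdotNl n (u v : 'cV[C]_n) : rdot (- v) u = - rdot v u.
Proof. by rewrite !(rdotC _ u) rdotNr. Qed.

Lemma rdotZr n (u v : 'cV[C]_n) (a : R) : rdot u (a%:C%C *: v) = a * rdot u v.
Proof.
rewrite !rdotE mulr_sumr; apply: eq_bigr => i _.
by rewrite !mxE; case: (v i 0) => c d /=; ring.
Qed.

Lemma rdotZl n (u v : 'cV[C]_n) (a : R) : rdot (a%:C%C *: v) u = a * rdot v u.
Proof. by rewrite !(rdotC _ u) rdotZr. Qed.

Lemma sqnormZ n (u : 'cV[C]_n) (a : C) :
  sqnorm (a *: u) = Normc.normc a ^+ 2 * sqnorm u.
Proof.
rewrite /sqnorm mulr_sumr; apply: eq_bigr => i _.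
by rewrite mxE Normc.normcM exprMn.
Qed.

Lemma rdot_adj m n (A : 'M[C]_(m, n)) u v : rdot u (A *m v) = rdot (A^t* *m u) v.
Proof. by rewrite /rdot adjM adjK mulmxA. Qed.

Definition isometry m n (V : 'M[C]_(m, n)) := V^t* *m V = 1%:M.

Lemma rdot_iso m n (V : 'M[C]_(m, n)) u v :
  isometry V -> rdot (V *m u) (V *m v) = rdot u v.
Proof. by move=> hV; rewrite rdot_adj mulmxA hV mul1mx. Qed.

Lemma sqnorm_iso m n (V : 'M[C]_(m, n)) u :
  isometry V -> sqnorm (V *m u) = sqnorm u.
Proof. by move=> hV; rewrite !sqnormE rdot_iso. Qed.

Lemma isometryM m n p (A : 'M[C]_(m, n)) (B : 'M[C]_(n, p)) :
  isometry A -> isometry B -> isometry (A *m B).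
Proof.
by rewrite /isometry adjM => hA hB; rewrite mulmxA -(mulmxA _ _ A) hA mulmx1.
Qed.

Lemma isometry1 n : isometry (1%:M : 'M[C]_n).
Proof. by rewrite /isometry adj1 mulmx1. Qed.

Lemma isometry_tens m n p q (A : 'M[C]_(m, n)) (B : 'M[C]_(p, q)) :
  isometry A -> isometry B -> isometry (A *t B).
Proof. by rewrite /isometry adj_tens tensmx_mul => -> ->; rewrite tens11. Qed.

Lemma isometry_adj n (A : 'M[C]_n) : isometry A -> isometry (A^t*).
Proof. by rewrite /isometry adjK => /mulmx1C. Qed.

Lemma unitary_isometry n (A : 'M[C]_n) : A \is unitarymx -> isometry A.
Proof. by move=> /unitarymxP /mulmx1C. Qed.

Lemma isometry_vec n (u : 'cV[C]_n) : sqnorm u = 1 -> isometry u.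
Proof. by rewrite /isometry adj_self => ->. Qed.

Lemma sqnormD n (u v : 'cV[C]_n) : sqnorm (u + v) = sqnorm u + 2 * rdot u v + sqnorm v.
Proof. rewrite !sqnormE rdotDr !rdotDl (rdotC v u); ring. Qed.

Lemma sqnormN n (u : 'cV[C]_n) : sqnorm (- u) = sqnorm u.
Proof. by rewrite !sqnormE rdotNl rdotNr opprK. Qed.

(** The polynomial |u + t v|^2 in t is nonnegative; evaluate it at its minimum t = - <u, v> /
    |v|^2. *)
Lemma rdot_CS n (u v : 'cV[C]_n) : rdot u v ^+ 2 <= sqnorm u * sqnorm v.
Proof.
have h t : 0 <= sqnorm u + 2 * (t * rdot u v) + t ^+ 2 * sqnorm v.
  have := sqnorm_ge0 (u + t%:C%C *: v).
  rewrite sqnormD rdotZr sqnormE [sqnorm (_ *: _)]sqnormE rdotZl rdotZr.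
  by rewrite -!sqnormE; lra.
have [v0|v0] := eqVneq (sqnorm v) 0.
  have [->|r0] := eqVneq (rdot u v) 0; first by rewrite v0; nra.
  (* If |v| = 0 the polynomial is affine in t, and at this t it equals -1. *)
  have := h (- (sqnorm u + 1) / (2 * rdot u v)); rewrite v0 mulr0 addr0.
  have -> : - (sqnorm u + 1) / (2 * rdot u v) * rdot u v = - (sqnorm u + 1) / 2.
    by field.
  lra.
have := h (- rdot u v / sqnorm v).
have -> : sqnorm u + 2 * (- rdot u v / sqnorm v * rdot u v) +
   (- rdot u v / sqnorm v) ^+ 2 * sqnorm v =
   (sqnorm u * sqnorm v - rdot u v ^+ 2) / sqnorm v by field.
have vp : 0 < sqnorm v by rewrite lt_neqAle eq_sym v0 sqnorm_ge0.
by rewrite pmulr_lge0 ?invr_gt0 // subr_ge0.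
Qed.

End Adjoint.

(** * Averages of the powers of a unitary *)

Section Averaging.
Variables (R : realType) (n : nat).
Local Notation C := R[i].
Implicit Types (U : 'M[C]_n) (v psi : 'cV[C]_n).

Fixpoint mxpow U k : 'M[C]_n := if k is k'.+1 then U *m mxpow U k' else 1%:M.

Lemma mxpowD U k l : mxpow U (k + l) = mxpow U k *m mxpow U l.
Proof. by elim: k => [|k ih]; rewrite ?mul1mx //= ih mulmxA. Qed.

Lemma isometry_mxpow U k : isometry U -> isometry (mxpow U k).
Proof. by move=> hU; elim: k => [|k ih] /=; [exact: isometry1|exact: isometryM]. Qed.

(* The average of the first 2 ^ J powers of U (see [avg_sum]), factored in the way
   that successive Hadamard tests apply it. *)
Fixpoint avg U J : 'M[C]_n :=
  if J is J'.+1 then avg U J' *m ((1 / 2 : R)%:C%C *: (1%:M + mxpow U (2 ^ J')))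
  else 1%:M.

(** The factor 1 + U^(2^J) adds to the exponents k < 2^J the exponents 2^J + k, which doubles the
    range. *)
Lemma avg_sum U J :
  (2 ^+ J : R)%:C%C *: avg U J = \sum_(k < 2 ^ J) mxpow U k.
Proof.
elim: J => [|J ih] /=.
  by rewrite big_ord1 expr0 scale1r.
rewrite -scalemxAr scalerA -rmorphM /=.
have -> : 2 ^+ J.+1 * (1 / 2) = 2 ^+ J :> R by rewrite exprS; field.
rewrite scalemxAl ih expnS mul2n -addnn big_split_ord /=.
rewrite mulmxDr mulmx1; congr (_ + _).
rewrite mulmx_suml; apply: eq_bigr => i _.
by rewrite addnC mxpowD.
Qed.

Lemma avg_telescope U J v :
  (2 ^+ J : R)%:C%C *: (avg U J *m (U *m v - v)) = mxpow U (2 ^ J) *m v - v.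
Proof.
rewrite scalemxAl avg_sum mulmx_suml.
elim: (2 ^ J)%N => [|k ih]; first by rewrite big_ord0 /= mul1mx subrr.
rewrite big_ord_recr /= ih mulmxBr mulmxA.
have -> : mxpow U k *m U = mxpow U k.+1 by rewrite -addn1 mxpowD /= mulmx1.
by rewrite /= addrC addrA subrK.
Qed.

(** By the parallelogram identity, each factor (1 + W) / 2 with W an isometry is a contraction. *)
Lemma avg_le U J v : isometry U -> sqnorm (avg U J *m v) <= sqnorm v.
Proof.
move=> hU; elim: J v => [|J ih] v /=; first by rewrite mul1mx.
rewrite -mulmxA; apply: le_trans (ih _) _.
rewrite -scalemxAl mulmxDl mul1mx sqnormZ /= expr0n addr0 sqr_sqrtr ?sqr_ge0 //.
have hp : sqnorm (mxpow U (2 ^ J) *m v) = sqnorm v.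
  by apply/sqnorm_iso/isometry_mxpow.
have := sqnorm_ge0 (v - mxpow U (2 ^ J) *m v).
rewrite !sqnormD sqnormN rdotNr hp; move: (sqnorm v) (rdot _ _) => x y h; lra.
Qed.

Variables (U : 'M[C]_n) (psi v : 'cV[C]_n) (m : R).
Hypotheses (hU : isometry U) (psi1 : sqnorm psi = 1).
Hypothesis hv : U *m v = v + (Complex 0 (2 * m)) *: psi.

(** Telescoping at v gives 2 i m N B psi = U^N v - v with N = 2^J, and the right side has norm at
    most 2 |v|. *)
Lemma avg_upper J :
  m ^+ 2 * 4 ^+ J * sqnorm (avg U J *m psi) <= sqnorm v.
Proof.
have := avg_telescope U J v; rewrite hv addrC addKr -scalemxAr.
move=> /(congr1 (@sqnorm R n)); rewrite !sqnormZ /= => h.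
have hp : sqnorm (mxpow U (2 ^ J) *m v) = sqnorm v.
  by apply/sqnorm_iso/isometry_mxpow.
have h4 : sqnorm (mxpow U (2 ^ J) *m v - v) <= 4 * sqnorm v.
  have := sqnorm_ge0 (mxpow U (2 ^ J) *m v + v).
  by rewrite !sqnormD rdotNr sqnormN hp; lra.
move: h h4; rewrite !sqr_sqrtr ?addr_ge0 ?sqr_ge0 //.
move=> <-; set q := sqnorm _.
have -> : (4 : R) ^+ J = (2 ^+ J) ^+ 2 by rewrite -exprM mulnC exprM; congr (_ ^+ _); ring.
rewrite expr0n /= addr0 add0r; nra.
Qed.

Hypothesis rv : rdot v psi = 1.

(** Since v = U v - 2 i m psi and U preserves inner products, passing from k to k + 1 changes the
    product by at most 2 |m|. *)
Lemma rdot_pow_lb k : 1 - 2 * `|m| * k%:R <= rdot v (mxpow U k *m psi).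
Proof.
elim: k => [|k ih]; first by rewrite /= mul1mx rv mulr0 subr0.
have -> : rdot v (mxpow U k.+1 *m psi) =
  rdot v (mxpow U k *m psi) - rdot (Complex 0 (2 * m) *: psi) (mxpow U k.+1 *m psi).
  rewrite -{1}[v](addrK (Complex 0 (2 * m) *: psi)) -hv rdotDl rdotNl /=.
  by rewrite -!mulmxA rdot_iso.
set x := rdot (_ *: _) _.
suff : x <= 2 * `|m| by rewrite -natr1; lra.
have : x ^+ 2 <= (2 * `|m|) ^+ 2.
  apply: le_trans (rdot_CS _ _) _.
  rewrite sqnorm_iso ?psi1 ?mulr1; last exact: isometry_mxpow.
  rewrite sqnormZ psi1 mulr1 /= sqr_sqrtr ?addr_ge0 ?sqr_ge0 //.
  by rewrite expr0n add0r !exprMn (real_normK (num_real _)).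
move=> hx; apply: le_trans (ler_norm x) _.
by rewrite -ler_sqr ?nnegrE ?normr_ge0 ?mulr_ge0 // (real_normK (num_real _)).
Qed.

(** Averaging the linear bound over k < N keeps <v, B psi> above 1 - N |m|; Cauchy-Schwarz turns
    this into a bound on |B psi|. *)
Lemma avg_lower J : `|m| * 2 ^+ J <= 1 ->
  (1 - `|m| * 2 ^+ J) ^+ 2 <= sqnorm v * sqnorm (avg U J *m psi).
Proof.
move=> hm.
apply: le_trans (rdot_CS _ _).
have N0 : 0 < (2 ^+ J : R) by rewrite exprn_gt0.
suff h : 1 - `|m| * 2 ^+ J <= rdot v (avg U J *m psi).
  by rewrite ler_sqr ?nnegrE ?subr_ge0 //; apply: le_trans h; rewrite subr_ge0.
rewrite -(ler_pM2l N0) -rdotZr scalemxAl avg_sum mulmx_suml.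
have -> : rdot v (\sum_(i < 2 ^ J) mxpow U i *m psi) =
  \sum_(i < 2 ^ J) rdot v (mxpow U i *m psi).
  by rewrite /rdot mulmx_sumr summxE raddf_sum.
(* The i < N add up to N (N - 1) / 2, so a term |m| N is left over; it is nonnegative and gets
   dropped. *)
have E : \sum_(i < 2 ^ J) (1 - 2 * `|m| * i%:R) =
   2 ^+ J * (1 - `|m| * 2 ^+ J) + `|m| * 2 ^+ J.
  have -> : (2 : R) ^+ J = (2 ^ J)%:R by rewrite natrX.
  elim: (2 ^ J)%N => [|k ih]; first by rewrite big_ord0; ring.
  by rewrite big_ord_recr /= ih -natr1; ring.
apply: (@le_trans _ _ (\sum_(i < 2 ^ J) (1 - 2 * `|m| * i%:R))).
  by rewrite E lerDl mulr_ge0 // ltW.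
by apply: ler_sum => i _; apply: rdot_pow_lb.
Qed.

End Averaging.

(** * Compiling classical control into a process *)

(* [CTest h J ka kr] runs the test for the random variable [h y] with [2 ^ J] powers
   of the walk; it goes on with [ka] if the test accepts, with [kr] otherwise. *)
CoInductive program (R : realType) : Type :=
| COut (r : R)
| CTest (h : R -> R) (J : nat) (ka kr : program R).

Local Arguments prob : simpl never.

Section Trees.
Variables (R : realType) (dP dY w1 : nat).
Local Notation C := R[i].

(* A process up to the points where the control program takes over.  [pre] and
   [meas2] merge a known operation into the first measurement of a tree, which the
   guard condition would not allow below a corecursive call; only [embed] is
   corecursive. *)
Inductive tree : nat -> Type :=
| Branch (n : nat) (J : finType) (dim : J -> nat) (M : forall i, 'M[C]_(dim i, n))
    (_ : \sum_i (M i)^t* *m M i = 1%:M)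
    (next : forall i, leaf (dim i)) : tree n
with leaf : nat -> Type :=
| Ask (x : box) (w : nat) (t : tree (box_dim dP dY x * w)) : leaf (box_dim dP dY x * w)
| Done (c : program R) : leaf (box_dim dP dY BoxP * w1).

Lemma pre_proof m n (V : 'M[C]_(m, n)) (J : finType) (dim : J -> nat)
  (M : forall i, 'M[C]_(dim i, m)) : isometry V ->
  \sum_i (M i)^t* *m M i = 1%:M -> \sum_i (M i *m V)^t* *m (M i *m V) = 1%:M.
Proof.
move=> hV hM; transitivity (V^t* *m (1%:M *m V)); last by rewrite mul1mx.
rewrite -hM mulmx_suml mulmx_sumr.
by apply: eq_bigr => i _; rewrite adjM !mulmxA.
Qed.

Definition pre m n (V : 'M[C]_(m, n)) (hV : isometry V) (t : tree m) : tree n :=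
  match t in tree m return forall V : 'M[C]_(m, n), isometry V -> tree n with
  | Branch _ _ _ M hM next => fun V hV => Branch (pre_proof hV hM) next
  end V hV.

Lemma meas2_proof n m1 m2 (E : 'M[C]_(m1, n)) (F : 'M[C]_(m2, n))
  (J1 J2 : finType) (dim1 : J1 -> nat) (dim2 : J2 -> nat)
  (M1 : forall i, 'M[C]_(dim1 i, m1)) (M2 : forall i, 'M[C]_(dim2 i, m2))
  (dim := fun i => match i with inl i => dim1 i | inr i => dim2 i end)
  (M := fun i : J1 + J2 => match i return 'M[C]_(dim i, n) with
    inl i => M1 i *m E | inr i => M2 i *m F end) :
  E^t* *m E + F^t* *m F = 1%:M ->
  \sum_i (M1 i)^t* *m M1 i = 1%:M -> \sum_i (M2 i)^t* *m M2 i = 1%:M ->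
  \sum_i (M i)^t* *m M i = 1%:M.
Proof.
move=> hEF h1 h2; rewrite big_sumType /= -hEF.
transitivity (E^t* *m (1%:M *m E) + F^t* *m (1%:M *m F)); last by rewrite !mul1mx.
rewrite -{1}h1 -h2 !mulmx_suml !mulmx_sumr.
by congr (_ + _); apply: eq_bigr => i _; rewrite adjM !mulmxA.
Qed.

Definition meas2 n m1 m2 (E : 'M[C]_(m1, n)) (F : 'M[C]_(m2, n))
    (hEF : E^t* *m E + F^t* *m F = 1%:M) (t1 : tree m1) (t2 : tree m2) : tree n :=
  match t1 in tree m1, t2 in tree m2 return
    forall (E : 'M[C]_(m1, n)) (F : 'M[C]_(m2, n)),
      E^t* *m E + F^t* *m F = 1%:M -> tree n with
  | Branch _ _ _ M1 h1 next1, Branch _ _ _ M2 h2 next2 => fun E F hEF =>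
    Branch (meas2_proof hEF h1 h2)
      (fun i => match i with inl i => next1 i | inr i => next2 i end)
  end E F hEF.

Variable rdy : 'cV[C]_(box_dim dP dY BoxP * w1).
Hypothesis rdy1 : sqnorm rdy = 1.

Lemma finish_proof n :
  \sum_i (rdy *m (delta_mx 0 i : 'rV[C]_n))^t* *m (rdy *m (delta_mx 0 i : 'rV[C]_n)) = 1%:M.
Proof.
rewrite mx1_sum_delta; apply: eq_bigr => i _.
rewrite adjM adj_delta mulmxA -(mulmxA _ _ rdy) (isometry_vec rdy1) mulmx1.
by rewrite mul_delta_mx.
Qed.

(* The register is measured in the computational basis and reset to [rdy], the
   input of the first query of the next test. *)
Definition finish (c : program R) n : tree n :=
  Branch (finish_proof n) (fun _ => Done c).

Variable body : (R -> R) -> nat -> program R -> program R -> tree (box_dim dP dY BoxP * w1).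

(** Every corecursive call sits under a query. At a [Done] leaf the first query of the next test, a
    use of P on the register [rdy], is issued here, and [body] is the rest of the test. *)
CoFixpoint embed n (t : tree n) : process R dP dY n :=
  match t in tree n return process R dP dY n with
  | Branch _ _ _ _ hM next => Measure hM (fun i =>
    match next i in leaf m return action R dP dY m with
    | Ask _ _ t => Query (embed t)
    | Done c => match c with
      | COut r => Output dP dY _ r
      | CTest h J ka kr => Query (embed (body h J ka kr))
      end
    end)
  end.

Definition rdy_proof : \sum_(i : unit) rdy^t* *m rdy = 1%:M.
Proof. by rewrite big_const card_unit /= addr0 (isometry_vec rdy1). Qed.

Definition compile (c : program R) : process R dP dY 1 :=
  embed (Branch (J := unit) rdy_proof (fun _ => Done c)).

(** * Success probabilities of trees and programs *)

Variables (P : 'M[C]_dP) (Y : 'M[C]_dY) (good : pred R).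

Definition aval N m (a : action R dP dY m) : 'cV[C]_m -> R :=
  match a in action _ _ _ m return 'cV[C]_m -> R with
  | Output _ r => fun phi => if good r then sqnorm phi else 0
  | Query x w A => fun phi => if N is N'.+1
      then prob P Y good N' A ((box_op P Y x *t (1%:M : 'M_w)) *m phi) else 0
  end.

Lemma prob_Measure N n (J : finType) dim (M : forall i : J, 'M[C]_(dim i, n))
  (h : \sum_i (M i)^t* *m M i = 1%:M) (next : forall i, action R dP dY (dim i)) psi :
  prob P Y good N (Measure h next) psi = \sum_i aval N (next i) (M i *m psi).
Proof. by case: N. Qed.

Lemma aval_ge0 N :
  (forall n (A : process R dP dY n) psi, 0 <= prob P Y good N A psi) ->
  forall m (a : action R dP dY m) phi, 0 <= aval N.+1 a phi.
Proof. by move=> h m [k r|x w A] phi /=; [case: ifP => _; rewrite ?sqnorm_ge0|]. Qed.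

Lemma prob_ge0 N n (A : process R dP dY n) psi : 0 <= prob P Y good N A psi.
Proof.
elim: N n A psi => [|N ih] n [m J dim M h next] psi; rewrite prob_Measure;
  apply: sumr_ge0 => i _; last exact: aval_ge0.
by case: (next i) (_ *m _) => [k r|x w A] phi //=; case: ifP => _; rewrite ?sqnorm_ge0.
Qed.

Lemma prob_leS N n (A : process R dP dY n) psi :
  prob P Y good N A psi <= prob P Y good N.+1 A psi.
Proof.
elim: N n A psi => [|N ih] n [m J dim M h next] psi; rewrite !prob_Measure;
  apply: ler_sum => i _; case: (next i) (_ *m _) => [k r|x w A] phi //=;
  first [exact: ih|exact: prob_ge0].
Qed.

Lemma prob_le N N' n (A : process R dP dY n) psi : (N <= N')%N ->
  prob P Y good N A psi <= prob P Y good N' A psi.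
Proof.
move=> /subnK <-; elim: (N' - N)%N => // k ih.
by apply: le_trans ih _; exact: prob_leS.
Qed.

(** States are unnormalized, so the value is quadratic in the state; this lets the weight of an
    outcome factor out. *)
Lemma probZ N n (A : process R dP dY n) psi a :
  prob P Y good N A (a *: psi) = Normc.normc a ^+ 2 * prob P Y good N A psi.
Proof.
elim: N n A psi => [|N ih] n [m J dim M h next] psi; rewrite !prob_Measure mulr_sumr;
  apply: eq_bigr => i _; rewrite -scalemxAr;
  case: (next i) (_ *m _) => [k r|x w A] phi //=;
  rewrite ?mulr0 ?sqnormZ //; do ?case: ifP => _; rewrite ?mulr0 //.
by rewrite -scalemxAr ih.
Qed.

Definition lval N m (l : leaf m) : 'cV[C]_m -> R :=
  match l in leaf m return 'cV[C]_m -> R with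
  | Ask x w t => fun phi => if N is N'.+1
      then prob P Y good N' (embed t) ((box_op P Y x *t (1%:M : 'M_w)) *m phi) else 0
  | Done (COut r) => fun phi => if good r then sqnorm phi else 0
  | Done (CTest h J ka kr) => fun phi => if N is N'.+1
      then prob P Y good N' (embed (body h J ka kr))
        ((box_op P Y BoxP *t (1%:M : 'M_w1)) *m phi) else 0
  end.

Definition tval N n (t : tree n) psi := prob P Y good N (embed t) psi.

Lemma tval_Branch N n (J : finType) dim (M : forall i : J, 'M[C]_(dim i, n))
  (h : \sum_i (M i)^t* *m M i = 1%:M) (next : forall i, leaf (dim i)) psi :
  tval N (Branch h next) psi = \sum_i lval N (next i) (M i *m psi).
Proof.
by case: N => [|N]; rewrite /tval /=; apply: eq_bigr => i _;
  case: (next i) (_ *m _) => [x w t|[r|h' J' ka kr]] phi.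
Qed.

Lemma tval_pre N m n (V : 'M[C]_(m, n)) (hV : isometry V) (t : tree m) psi :
  tval N (pre hV t) psi = tval N t (V *m psi).
Proof.
case: t V hV => {}m J dim M h next V hV; rewrite !tval_Branch.
by apply: eq_bigr => i _; rewrite mulmxA.
Qed.

Lemma tval_meas2 N n m1 m2 (E : 'M[C]_(m1, n)) (F : 'M[C]_(m2, n))
    (hEF : E^t* *m E + F^t* *m F = 1%:M) t1 t2 psi :
  tval N (meas2 hEF t1 t2) psi = tval N t1 (E *m psi) + tval N t2 (F *m psi).
Proof.
case: t1 t2 E F hEF => {}m1 J1 dim1 M1 h1 next1 [{}m2 J2 dim2 M2 h2 next2] E F hEF.
rewrite !tval_Branch big_sumType /=.
by congr (_ + _); apply: eq_bigr => i _; rewrite mulmxA.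
Qed.

Definition pr c N : R := lval N (Done c) rdy.

Lemma lval_DoneZ N c a phi :
  lval N (Done c) (a *: phi) = Normc.normc a ^+ 2 * lval N (Done c) phi.
Proof.
case: c => [r|h J ka kr] /=.
  by case: ifP => _; rewrite ?mulr0 // sqnormZ.
by case: N => [|N]; rewrite ?mulr0 // -scalemxAr probZ.
Qed.

(** Outcome i leaves [rdy] scaled by the i-th entry of psi; by homogeneity the weights add up to
    |psi|^2, and what follows forgets the measured state. *)
Lemma tval_finish N c n psi : tval N (finish c n) psi = sqnorm psi * pr c N.
Proof.
rewrite tval_Branch /sqnorm mulr_suml; apply: eq_bigr => i _.
rewrite -lval_DoneZ; congr (lval N (Done c) _).
rewrite -mulmxA -rowE [row i psi]mx11_scalar mul_mx_scalar mxE //.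
Qed.

Lemma prob_compile N c : prob P Y good N (compile c) (const_mx 1) = pr c N.
Proof.
rewrite -[LHS]/(tval _ _ _) tval_Branch big_const card_unit /= addr0.
by congr (lval N (Done c) _); apply/matrixP => i j; rewrite !mxE big_ord1 !mxE mulr1 [j]ord1.
Qed.

Lemma pr_ge0 c N : 0 <= pr c N.
Proof. by rewrite -prob_compile prob_ge0. Qed.

Lemma pr_le c N N' : (N <= N')%N -> pr c N <= pr c N'.
Proof. by rewrite -!prob_compile; exact: prob_le. Qed.

Lemma pr_COut r N : good r -> pr (COut r) N = 1.
Proof. by rewrite /pr /= => ->. Qed.

End Trees.

(** * Permutations of tensor factors, controlled operators and reflections *)

Section Reindexing.
Variable R : realType.
Local Notation C := R[i].

Lemma tensmxDl m n p q (A B : 'M[C]_(m, n)) (D : 'M[C]_(p, q)) :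
  (A + B) *t D = A *t D + B *t D.
Proof. by apply/matrixP => i j; rewrite !mxE mulrDl. Qed.

Lemma tensmxDr m n p q (A B : 'M[C]_(m, n)) (D : 'M[C]_(p, q)) :
  D *t (A + B) = D *t A + D *t B.
Proof. by apply/matrixP => i j; rewrite !mxE mulrDr. Qed.

Lemma tensmxZl m n p q a (A : 'M[C]_(m, n)) (D : 'M[C]_(p, q)) :
  (a *: A) *t D = a *: (A *t D).
Proof. by apply/matrixP => i j; rewrite !mxE mulrA. Qed.

Lemma tensmxZr m n p q a (A : 'M[C]_(m, n)) (D : 'M[C]_(p, q)) :
  D *t (a *: A) = a *: (D *t A).
Proof. by apply/matrixP => i j; rewrite !mxE mulrCA. Qed.

(** For bijective f, a permutation matrix. Two index types are allowed because the dimensions agree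
    only up to rearranging products, not by computation. *)
Definition reindex_mx m n (f : 'I_m -> 'I_n) : 'M[C]_(m, n) := \matrix_(i, j) (j == f i)%:R.

Lemma reindex_mx_mul m n p (f : 'I_m -> 'I_n) (X : 'M[C]_(n, p)) i j :
  (reindex_mx f *m X) i j = X (f i) j.
Proof.
rewrite mxE (bigD1 (f i)) //= mxE eqxx mul1r big1 ?addr0 // => k kf.
by rewrite mxE (negbTE kf) mul0r.
Qed.

Lemma mul_reindex_mx m n p (f : 'I_m -> 'I_n) (g : 'I_n -> 'I_m) (X : 'M[C]_(p, m)) i j :
  cancel f g -> cancel g f -> (X *m reindex_mx f) i j = X i (g j).
Proof.
move=> fK gK; rewrite mxE (bigD1 (g j)) //= mxE gK eqxx mulr1 big1 ?addr0 // => k kg.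
by rewrite mxE eq_sym (can2_eq fK gK) (negbTE kg) mulr0.
Qed.

Lemma reindex_mx_isometry m n (f : 'I_m -> 'I_n) (g : 'I_n -> 'I_m) :
  cancel f g -> cancel g f -> isometry (reindex_mx f).
Proof.
move=> fK gK; apply/matrixP => i j; rewrite (mul_reindex_mx _ _ _ fK gK) !mxE gK.
by rewrite rmorph_nat.
Qed.

Lemma reindex_mx_coisometry m n (f : 'I_m -> 'I_n) (g : 'I_n -> 'I_m) :
  cancel f g -> cancel g f -> isometry ((reindex_mx f)^t*).
Proof.
move=> fK gK; rewrite /isometry adjK; apply/matrixP => i j.
by rewrite reindex_mx_mul !mxE rmorph_nat (can_eq fK).
Qed.

(* P acts on the registers a, g and Y on the registers a, b, c: the shuffle brings
   to the front the registers of Y. *)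
Section Shuffle.
Variables o a g b c k : nat.

Definition shuffle (i : 'I_(o * (a * b * c) * (g * k))) : 'I_(o * (a * g) * (b * c * k)) :=
  let: (x, y) := mxtens_unindex i in
  let: (io, z) := mxtens_unindex x in
  let: (iab, ic) := mxtens_unindex z in
  let: (ia, ib) := mxtens_unindex iab in
  let: (ig, ik) := mxtens_unindex y in
  mxtens_index (mxtens_index (io, mxtens_index (ia, ig)),
                mxtens_index (mxtens_index (ib, ic), ik)).

Definition unshuffle (i : 'I_(o * (a * g) * (b * c * k))) : 'I_(o * (a * b * c) * (g * k)) :=
  let: (x, y) := mxtens_unindex i in
  let: (io, z) := mxtens_unindex x in
  let: (ia, ig) := mxtens_unindex z in
  let: (ibc, ik) := mxtens_unindex y in
  let: (ib, ic) := mxtens_unindex ibc in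
  mxtens_index (mxtens_index (io, mxtens_index (mxtens_index (ia, ib), ic)),
                mxtens_index (ig, ik)).

Lemma shuffleK : cancel shuffle unshuffle.
Proof.
move=> i; case: (mxtens_indexP i) => x y; case: (mxtens_indexP x) => io z.
case: (mxtens_indexP z) => iab ic; case: (mxtens_indexP iab) => ia ib.
case: (mxtens_indexP y) => ig ik.
by rewrite /shuffle !mxtens_indexK /unshuffle !mxtens_indexK.
Qed.

Lemma unshuffleK : cancel unshuffle shuffle.
Proof.
move=> i; case: (mxtens_indexP i) => x y; case: (mxtens_indexP x) => io z.
case: (mxtens_indexP z) => ia ig; case: (mxtens_indexP y) => ibc ik.
case: (mxtens_indexP ibc) => ib ic.
by rewrite /unshuffle !mxtens_indexK /shuffle !mxtens_indexK.
Qed.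

Definition shuffle_mx := reindex_mx shuffle.
Lemma shuffle_mx_isometry : isometry shuffle_mx.
Proof. exact: reindex_mx_isometry shuffleK unshuffleK. Qed.
Lemma shuffle_mx_coisometry : isometry (shuffle_mx^t*).
Proof. exact: reindex_mx_coisometry shuffleK unshuffleK. Qed.
End Shuffle.

(** Naturality: the shuffle moves past any operator of product form. The factors may be rectangular,
    so that this also covers column vectors. *)
Lemma shuffle_mx_tens o a g b c k o' a' g' b' c' k'
  (O : 'M[C]_(o, o')) (A : 'M[C]_(a, a')) (G : 'M[C]_(g, g'))
  (B : 'M[C]_(b, b')) (D : 'M[C]_(c, c')) (K : 'M[C]_(k, k')) :
  shuffle_mx o a g b c k *m ((O *t (A *t G)) *t ((B *t D) *t K)) =
  ((O *t ((A *t B) *t D)) *t (G *t K)) *m shuffle_mx o' a' g' b' c' k'.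
Proof.
apply/matrixP => i j.
rewrite reindex_mx_mul (mul_reindex_mx _ _ _ (@shuffleK _ _ _ _ _ _) (@unshuffleK _ _ _ _ _ _)).
case: (mxtens_indexP i) => x y; case: (mxtens_indexP x) => io z.
case: (mxtens_indexP z) => iab ic; case: (mxtens_indexP iab) => ia ib.
case: (mxtens_indexP y) => ig ik.
case: (mxtens_indexP j) => x' y'; case: (mxtens_indexP x') => io' z'.
case: (mxtens_indexP z') => ia' ig'; case: (mxtens_indexP y') => ibc' ik'.
case: (mxtens_indexP ibc') => ib' ic'.
rewrite /shuffle /unshuffle !mxtens_indexK !tensmxE.
rewrite !mulrA; congr (_ * _); rewrite -!mulrA; congr (_ * (_ * _)).
by rewrite mulrC -!mulrA.
Qed.

(** For a product of column vectors, the shuffle on the domain side is this trivial one. *)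
Lemma shuffle_mx11 : shuffle_mx 1 1 1 1 1 1 = 1%:M.
Proof.
apply/matrixP => i j; rewrite [LHS]mxE [RHS]mxE.
have e (x y : 'I_1) : (x == y) = true by rewrite !ord1.
congr (_%:R); congr (nat_of_bool _); transitivity true; [exact: e|exact/esym/e].
Qed.

(* The controlled version of M, when [J0] and [J1] embed a register as the
   branches of a control qubit. *)
Definition ctrl m n (J0 J1 : 'M[C]_(m, n)) (M : 'M[C]_n) : 'M[C]_m :=
  J0 *m J0^t* + J1 *m M *m J1^t*.

Section Ctrl.
Variables (m n : nat) (J0 J1 : 'M[C]_(m, n)).
Hypotheses (h00 : J0^t* *m J0 = 1%:M) (h11 : J1^t* *m J1 = 1%:M).
Hypotheses (h01 : J0^t* *m J1 = 0) (hJ : J0 *m J0^t* + J1 *m J1^t* = 1%:M).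

Lemma h01_adj : J1^t* *m J0 = 0.
Proof. by rewrite -[LHS]adjK adjM adjK h01 trmx0 map_mx0. Qed.

Lemma ctrl0 M : ctrl J0 J1 M *m J0 = J0.
Proof. by rewrite mulmxDl -!mulmxA h00 h01_adj !mulmx0 mulmx1 addr0. Qed.

Lemma ctrl1 M : ctrl J0 J1 M *m J1 = J1 *m M.
Proof. by rewrite mulmxDl -!mulmxA h01 h11 !mulmx0 mulmx1 add0r. Qed.

Lemma ctrl_mul A B : ctrl J0 J1 A *m ctrl J0 J1 B = ctrl J0 J1 (A *m B).
Proof. by rewrite {2}/ctrl mulmxDr !mulmxA ctrl0 ctrl1 -(mulmxA J1). Qed.

Lemma adj_ctrl A : (ctrl J0 J1 A)^t* = ctrl J0 J1 (A^t*).
Proof.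
rewrite /ctrl adjD [(J0 *m _)^t*]adjM [(_ *m J1^t*)^t*]adjM [(J1 *m A)^t*]adjM.
by rewrite (adjK J0) (adjK J1) mulmxA.
Qed.

Lemma ctrl_isometry A : isometry A -> isometry (ctrl J0 J1 A).
Proof. by move=> hA; rewrite /isometry adj_ctrl ctrl_mul hA /ctrl mulmx1. Qed.

(** For s = 1 and s = -1, the register is embedded with the control qubit in the state (|0> + s |1>)
    / sqrt 2. *)
Definition hadamard (s : R) : 'M[C]_(m, n) := (Num.sqrt (1 / 2) : R)%:C%C *: (J0 + s%:C%C *: J1).

Lemma hadamard_isometry : isometry (hadamard 1).
Proof.
rewrite /isometry /hadamard scale1r adjZ adjD -scalemxAl -scalemxAr mulmxDl !mulmxDr.
rewrite h00 h11 h01 h01_adj addr0 add0r -mulr2n -scaler_nat !scalerA -[RHS]scale1r.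
congr (_ *: _); rewrite conjCc conjc_real -(rmorph_nat (real_complex R)) -!rmorphM /=.
set s := Num.sqrt _; have s2 : s * s = 1 / 2 by rewrite -expr2 sqr_sqrtr //; lra.
by apply: (@congr1 _ _ (real_complex R) _ 1); lra.
Qed.

Lemma adj_hadamard s :
  (hadamard s)^t* = (Num.sqrt (1 / 2) : R)%:C%C *: (J0^t* + s%:C%C *: J1^t*).
Proof. by rewrite /hadamard adjZ adjD adjZ !conjCc !conjc_real. Qed.

Lemma hadamard_complete :
  hadamard 1 *m (hadamard 1)^t* + hadamard (-1) *m (hadamard (-1))^t* = 1%:M.
Proof.
have e s : hadamard s *m (hadamard s)^t* =
    (1 / 2 : R)%:C%C *: ((J0 + s%:C%C *: J1) *m (J0^t* + s%:C%C *: J1^t*)).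
  rewrite adj_hadamard /hadamard -scalemxAl -scalemxAr scalerA.
  by rewrite -rmorphM /= -expr2 sqr_sqrtr //; lra.
have abel (x y z t : 'M[C]_m) : x + z + (t + y) + (x - z + (y - t)) = (x + y) + (x + y).
  by apply/matrixP => i j; rewrite !mxE; ring.
rewrite !e -scalerDr rmorphN rmorph1 (scale1r J1) (scale1r (J1^t*)).
rewrite (scaleN1r J1) (scaleN1r (J1^t*)) !mulmxDl !mulmxDr !mulNmx !mulmxN opprK.
rewrite [- (J1 *m J0^t*) + _]addrC.
rewrite abel hJ -mulr2n -scaler_nat scalerA -[RHS]scale1r; congr (_ *: _).
by rewrite -(rmorph_nat (real_complex R)) -rmorphM /= mul1r mulVf // pnatr_eq0.
Qed.

(** Preparing the control in |+>, applying the controlled M and projecting on |+> again amounts to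
    (1 + M) / 2, one factor of [avg]. *)
Lemma hadamard_test (W : 'M[C]_m) (M : 'M[C]_n) :
  W *m J0 = J0 -> W *m J1 = J1 *m M ->
  (hadamard 1)^t* *m (W *m hadamard 1) = (1 / 2 : R)%:C%C *: (1%:M + M).
Proof.
move=> w0 w1; rewrite /hadamard scale1r adjZ adjD -scalemxAl -!scalemxAr.
rewrite mulmxDr w0 w1 mulmxDl !mulmxDr !mulmxA h00 h11 h01 h01_adj mul0mx mul1mx.
rewrite addr0 add0r scalerA conjCc conjc_real -rmorphM /= -expr2 sqr_sqrtr //; lra.
Qed.
End Ctrl.

Lemma sqnorm_complete n m1 m2 (E : 'M[C]_(m1, n)) (F : 'M[C]_(m2, n)) v :
  E^t* *m E + F^t* *m F = 1%:M -> sqnorm (E *m v) + sqnorm (F *m v) = sqnorm v.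
Proof.
by move=> h; rewrite !sqnormE !rdot_adj !mulmxA -rdotDl -mulmxDl h mul1mx.
Qed.

Definition reflection n (x : 'cV[C]_n) : 'M[C]_n := (2 : R)%:C%C *: (x *m x^t*) - 1%:M.

Lemma reflection_isometry n (x : 'cV[C]_n) : sqnorm x = 1 -> isometry (reflection x).
Proof.
move=> x1; rewrite /isometry /reflection adjB adj1 adjZ adjM adjK.
rewrite conjCc conjc_real mulmxBl !mulmxBr mul1mx !mulmx1 -scalemxAl -scalemxAr.
rewrite mulmxA -(mulmxA x) (isometry_vec x1) mulmx1 scalerA.
set y := x *m _; rewrite opprB addrA addrAC; apply/eqP.
rewrite -subr_eq0 addrAC; apply/eqP/matrixP => i j; rewrite !mxE -rmorphM /=.
have -> : (2 * 2 : R) = 2 + 2 by ring.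
rewrite rmorphD /=; ring.
Qed.

End Reindexing.

(** * The walk and its Hadamard test *)

Definition cayley (R : realType) (z : R) : R[i] := (Complex 1 z) / (Complex 1 (- z)).

Lemma cayleyE (R : realType) (z : R) : cayley z * Complex 1 (- z) = Complex 1 z.
Proof.
by rewrite /cayley divfK // eq_complex /= oner_eq0.
Qed.

Lemma cayley_unit (R : realType) (z : R) : (cayley z)^* * cayley z = 1.
Proof.
have nz (t : R) : Complex 1 t != 0 :> R[i].
  by rewrite eq_complex /= oner_eq0.
rewrite /cayley rmorphM fmorphV /= !conjCc /= opprK.
by rewrite mulrACA -invfM mulrC [X in X^-1 * _]mulrC mulVf // mulf_neq0.
Qed.

Section AdjointFacts.
Variable R : realType.
Local Notation C := R[i].

Lemma complete_adj n m1 m2 (V : 'M[C]_(n, m1)) (W : 'M[C]_(n, m2)) :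
  V *m V^t* + W *m W^t* = 1%:M -> V^t*^t* *m V^t* + W^t*^t* *m W^t* = 1%:M.
Proof. by rewrite !adjK. Qed.

Lemma isometryK m n p (V : 'M[C]_(m, n)) (v : 'M[C]_(n, p)) :
  isometry V -> V^t* *m (V *m v) = v.
Proof. by move=> hV; rewrite mulmxA hV mul1mx. Qed.

Lemma orthogonalK m n p q (V : 'M[C]_(m, n)) (W : 'M[C]_(m, p)) (v : 'M[C]_(p, q)) :
  V^t* *m W = 0 -> V^t* *m (W *m v) = 0.
Proof. by move=> h; rewrite mulmxA h mul0mx. Qed.

Lemma sqnorm0 n : sqnorm (0 : 'cV[C]_n) = 0.
Proof. by rewrite /sqnorm big1 // => i _; rewrite mxE Normc.normc0 expr0n. Qed.

Lemma mix_le (x s a A B B' T : R) :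
  s * B <= s * B' -> a * A + (x - a) * B <= T -> a * A + (x + s - a) * B <= T + s * B'.
Proof. lra. Qed.

End AdjointFacts.

(** * The circuit of the test, its cost and its acceptance probability *)

Section Circuits.
Variables (R : realType) (na ng nb nc : nat).
Local Notation C := R[i].
Local Notation dP := (na * ng)%N.
Local Notation dY := (na * nb * nc)%N.
Local Notation w1 := (nb * nc * 1)%N.
Local Notation regP q := (1 * dP * (nb * nc * q))%N.
Local Notation regY q := (1 * dY * (ng * q))%N.
Local Notation tree := (tree R dP dY w1).

Variables (init : 'cV[C]_dP) (zb : 'I_nb) (zc : 'I_nc) (val_dec : 'I_nb -> R).
Hypothesis init1 : sqnorm init = 1.

Definition gate_dim x := match x with BoxP | BoxPdag => dP | BoxY | BoxYdag => dY end.

(** The unit factor in [1 * gate_dim x] is what remains of the control qubit once its state is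
    fixed; it keeps the bracketing parallel to that of the box. *)
Definition box_embed (s : 'I_2) x w : 'M[C]_(box_dim dP dY x * w, 1 * gate_dim x * w) :=
  match x return 'M[C]_(box_dim dP dY x * w, 1 * gate_dim x * w) with
  | BoxP | BoxPdag => ((ket R s) *t (1%:M : 'M_dP)) *t 1%:M
  | BoxY | BoxYdag => ((ket R s) *t (1%:M : 'M_dY)) *t 1%:M
  end.

Lemma sqnorm_ket n (i : 'I_n) : sqnorm (ket R i) = 1.
Proof.
rewrite /sqnorm (bigD1 i) //= mxE !eqxx Normc.normc1 big1 => [|j ji].
  by rewrite expr1n addr0.
by rewrite mxE (negbTE ji) Normc.normc0 expr0n.
Qed.

Lemma isometry_ket n (i : 'I_n) : isometry (ket R i).
Proof. exact/isometry_vec/sqnorm_ket. Qed.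

Lemma ket_ortho n (i j : 'I_n) : i != j -> (ket R i)^t* *m ket R j = 0.
Proof. by move=> ij; rewrite /ket adj_delta mul_delta_mx_0. Qed.

Lemma isometry_box_embed s x w : isometry (box_embed s x w).
Proof.
by case: x; apply: isometry_tens (isometry1 _ _); apply: isometry_tens (isometry1 _ _);
  apply: isometry_ket.
Qed.

Lemma box_embed01 x w : (box_embed 0 x w)^t* *m box_embed 1 x w = 0.
Proof. by case: x; rewrite !adj_tens !tensmx_mul ket_ortho // !tens0mx. Qed.

Lemma ket_complete : ket R (1 : 'I_2) *m (ket R 1)^t* + ket R (0 : 'I_2) *m (ket R 0)^t* = 1%:M.
Proof.
rewrite /ket !adj_delta !mul_delta_mx mx1_sum_delta big_ord_recl big_ord1 addrC.
by congr (_ + delta_mx _ _); apply: val_inj.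
Qed.

Lemma ket_tens_complete d w
  (E := fun s : 'I_2 => (ket R s *t (1%:M : 'M[C]_d)) *t (1%:M : 'M[C]_w)) :
  E 1 *m (E 1)^t* + E 0 *m (E 0)^t* = 1%:M.
Proof.
by rewrite /E !adj_tens !tensmx_mul -!tensmxDl ket_complete !adj1 !mulmx1 !tens11.
Qed.

Lemma box_embed_complete x w :
  (box_embed 1 x w)^t*^t* *m (box_embed 1 x w)^t* +
  (box_embed 0 x w)^t*^t* *m (box_embed 0 x w)^t* = 1%:M.
Proof. by apply: complete_adj; case: x; exact: ket_tens_complete. Qed.

Lemma controlled_ket1 d (U : 'M[C]_d) w :
  (controlled U *t (1%:M : 'M_w)) *m ((ket R 1 *t (1%:M : 'M_d)) *t 1%:M) =
  ((ket R 1 *t (1%:M : 'M_d)) *t 1%:M) *m ((1%:M *t U) *t (1%:M : 'M_w)).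
Proof.
rewrite !tensmx_mul !mulmx1; congr (_ *t _).
rewrite /controlled mulmxDl !tensmx_mul !mulmx1 mul1mx.
by rewrite /ket mul_delta_mx mul_delta_mx_0 // tens0mx add0r.
Qed.

Variable rdy : 'cV[C]_(box_dim dP dY BoxP * w1).
Hypothesis rdy1 : sqnorm rdy = 1.

Lemma single_proof n : \sum_(i : unit) (1%:M : 'M[C]_n)^t* *m (1%:M : 'M[C]_n) = 1%:M.
Proof. by rewrite big_const card_unit /= addr0 adj1 mulmx1. Qed.

(* The control qubit of the box is prepared in the state 1 and measured after the
   query, with a certain outcome: in effect, the uncontrolled gate is applied. *)
Definition ask x w (t : tree (1 * gate_dim x * w)) : tree (1 * gate_dim x * w) :=
  pre (isometry_box_embed 1 x w)
    (Branch (single_proof _) (fun _ => Ask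
      (meas2 (box_embed_complete x w) t (finish rdy1 (COut 0) _)))).


Definition Smx q : 'M[C]_(regY q, regP q) := shuffle_mx R 1 na ng nb nc q.

Lemma Smx_isometry q : isometry (Smx q). Proof. exact: shuffle_mx_isometry. Qed.
Lemma Smx_coisometry q : isometry ((Smx q)^t*). Proof. exact: shuffle_mx_coisometry. Qed.

Definition JP (s : 'I_2) : 'M[C]_(regP 2, regP 1) :=
  (1%:M : 'M_(1 * dP)) *t ((1%:M : 'M_(nb * nc)) *t ket R s).

Definition JY (s : 'I_2) : 'M[C]_(regY 2, regY 1) :=
  (1%:M : 'M_(1 * dY)) *t ((1%:M : 'M_ng) *t ket R s).

Lemma Smx_J s : Smx 2 *m JP s = JY s *m Smx 1.
Proof.
have -> : JP s = ((1%:M : 'M_1) *t ((1%:M : 'M_na) *t (1%:M : 'M_ng))) *t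
    (((1%:M : 'M_nb) *t (1%:M : 'M_nc)) *t ket R s) by rewrite !tens11.
by rewrite /Smx shuffle_mx_tens !tens11.
Qed.

Lemma SmxV_J s : (Smx 2)^t* *m JY s = JP s *m (Smx 1)^t*.
Proof.
have h : JY s = Smx 2 *m JP s *m (Smx 1)^t*.
  have := Smx_coisometry 1; rewrite /isometry adjK => h1.
  by rewrite Smx_J -mulmxA h1 mulmx1.
by rewrite h !mulmxA Smx_isometry mul1mx.
Qed.

Lemma JP_isometry s : isometry (JP s).
Proof.
by apply: isometry_tens (isometry1 _ _) _; apply: isometry_tens (isometry1 _ _) (isometry_ket _).
Qed.

Lemma JY_isometry s : isometry (JY s).
Proof.
by apply: isometry_tens (isometry1 _ _) _; apply: isometry_tens (isometry1 _ _) (isometry_ket _).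
Qed.

Lemma JP_ortho : (JP 0)^t* *m JP 1 = 0.
Proof. by rewrite !adj_tens !tensmx_mul ket_ortho // !tensmx0. Qed.

Lemma JY_ortho : (JY 0)^t* *m JY 1 = 0.
Proof. by rewrite !adj_tens !tensmx_mul ket_ortho // !tensmx0. Qed.

Lemma JP_complete : JP 0 *m (JP 0)^t* + JP 1 *m (JP 1)^t* = 1%:M.
Proof.
rewrite !adj_tens !tensmx_mul !adj1 !mulmx1 -!tensmxDr.
by rewrite [ket R 0 *m _ + _]addrC ket_complete !tens11.
Qed.

Lemma JY_complete : JY 0 *m (JY 0)^t* + JY 1 *m (JY 1)^t* = 1%:M.
Proof.
rewrite !adj_tens !tensmx_mul !adj1 !mulmx1 -!tensmxDr.
by rewrite [ket R 0 *m _ + _]addrC ket_complete !tens11.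
Qed.

Definition start : 'cV[C]_(regP 1) :=
  ((1%:M : 'M_1) *t init) *t ((ket R zb *t ket R zc) *t (1%:M : 'M_1)).

Lemma start1 : sqnorm start = 1.
Proof.
have h : isometry start := isometry_tens
  (isometry_tens (isometry1 _ 1) (isometry_vec init1))
  (isometry_tens (isometry_tens (isometry_ket zb) (isometry_ket zc)) (isometry1 _ 1)).
have := congr1 (fun M : 'M[C]_1 => complex.Re (M 0 0)) (adj_self start).
by rewrite (h : start^t* *m start = 1%:M) !mxE.
Qed.

Section Phases.
Variable h : R -> R.

Definition phases : 'M[C]_nb := diag_mx (\row_v cayley (h (val_dec v))).

Definition Phi : 'M[C]_(regY 1) :=
  ((1%:M : 'M_1) *t (((1%:M : 'M_na) *t phases) *t (1%:M : 'M_nc))) *t (1%:M : 'M_(ng * 1)).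

Lemma phases_isometry : isometry phases.
Proof.
rewrite /isometry /phases tr_diag_mx map_diag_mx mulmx_diag -diag_const_mx.
by congr diag_mx; apply/rowP => v; rewrite !mxE cayley_unit.
Qed.

Lemma Phi_isometry : isometry Phi.
Proof.
apply: isometry_tens (isometry1 _ _); apply: isometry_tens (isometry1 _ _) _.
by apply: isometry_tens (isometry1 _ _); apply: isometry_tens (isometry1 _ _) phases_isometry.
Qed.

Definition cPhi := ctrl (JY 0) (JY 1) Phi.
Definition cRefl := ctrl (JP 0) (JP 1) (reflection start).

Lemma cPhi_isometry : isometry cPhi.
Proof.
exact: (ctrl_isometry (JY_isometry 0) (JY_isometry 1) JY_ortho JY_complete Phi_isometry).
Qed.

Lemma cRefl_isometry : isometry cRefl.
Proof.
exact: (ctrl_isometry (JP_isometry 0) (JP_isometry 1) JP_ortho JP_complete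
  (reflection_isometry start1)).
Qed.

(* The walk controlled by the last qubit.  Only its known factors are controlled:
   without them the queries to each box and to its adjoint cancel. *)
Definition cU_tree (t : tree (regP 2)) : tree (regP 2) :=
  pre (Smx_isometry 2) (ask (x := BoxY) (pre cPhi_isometry (ask (x := BoxYdag)
    (pre (Smx_coisometry 2) (ask (x := BoxPdag) (pre cRefl_isometry (ask (x := BoxP) t))))))).

Fixpoint cU_iter k (t : tree (regP 2)) : tree (regP 2) :=
  if k is k'.+1 then cU_tree (cU_iter k' t) else t.

Definition had (s : R) := hadamard (JP 0) (JP 1) s.

Lemma had_isometry : isometry (had 1).
Proof.
exact: (hadamard_isometry (JP_isometry 0) (JP_isometry 1) JP_ortho).
Qed.

Lemma had_complete : (had 1)^t*^t* *m (had 1)^t* + (had (-1))^t*^t* *m (had (-1))^t* = 1%:M.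
Proof.
exact: (complete_adj (hadamard_complete JP_complete)).
Qed.

(** The factors of [avg] act from the right, hence the largest power comes first; a failed Hadamard
    test rejects at once. *)
Fixpoint test_tree J (ka kr : program R) : tree (regP 1) :=
  if J is J'.+1 then
    pre had_isometry (cU_iter (2 ^ J')
      (meas2 had_complete (test_tree J' ka kr) (finish rdy1 kr _)))
  else finish rdy1 ka _.

(** The query to P that prepares the state has been issued by [embed]; here its control qubit is
    removed. The outcome leading to [COut 0] has amplitude zero. *)
Definition test_body J ka kr : tree (box_dim dP dY BoxP * w1) :=
  meas2 (box_embed_complete BoxP w1) (test_tree J ka kr) (finish rdy1 (COut 0) _).
End Phases.

Variable body : (R -> R) -> nat -> program R -> program R -> tree (box_dim dP dY BoxP * w1).
Variables (P : 'M[C]_dP) (Y : 'M[C]_dY) (good : pred R).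
Local Notation tval := (tval body P Y good).

Definition gate x : 'M[C]_(gate_dim x) :=
  match x with BoxP => P | BoxPdag => P^t* | BoxY => Y | BoxYdag => Y^t* end.

Lemma box_box_embed x w : (box_op P Y x *t (1%:M : 'M_w)) *m box_embed 1 x w =
  box_embed 1 x w *m ((1%:M *t gate x) *t (1%:M : 'M_w)).
Proof. by case: x; apply: controlled_ket1. Qed.

(** On the range of V the other outcome has amplitude zero, so nothing is lost. *)
Lemma tval_meas2_adj N n m1 m2 (V : 'M[C]_(n, m1)) (W : 'M[C]_(n, m2))
    (hVW : V^t*^t* *m V^t* + W^t*^t* *m W^t* = 1%:M) t c psi :
  isometry V -> W^t* *m V = 0 ->
  tval N (meas2 hVW t (finish rdy1 c _)) (V *m psi) = tval N t psi.
Proof.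
move=> hV hWV; rewrite tval_meas2 tval_finish isometryK // orthogonalK //.
by rewrite sqnorm0 mul0r addr0.
Qed.

Lemma tval_ask N x w t psi :
  tval N.+1 (@ask x w t) psi = tval N t (((1%:M *t gate x) *t (1%:M : 'M_w)) *m psi).
Proof.
rewrite tval_pre tval_Branch big_const card_unit /= addr0 mul1mx.
have e : (box_op P Y x *t (1%:M : 'M_w)) *m (box_embed 1 x w *m psi) =
  box_embed 1 x w *m (((1%:M *t gate x) *t (1%:M : 'M_w)) *m psi).
  by rewrite mulmxA box_box_embed mulmxA.
apply: etrans (tval_meas2_adj _ (box_embed_complete x w) _ _ _
  (isometry_box_embed 1 x w) (box_embed01 x w)).
by rewrite -e.
Qed.

Local Notation lift X w := (((1%:M : 'M[C]_1) *t X) *t (1%:M : 'M_w)).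

Lemma liftM d w (X X' : 'M[C]_d) : lift X w *m lift X' w = lift (X *m X') w.
Proof. by rewrite !tensmx_mul !mulmx1. Qed.

Lemma lift1 d w : lift (1%:M : 'M[C]_d) w = 1%:M.
Proof. by rewrite !tens11. Qed.

Lemma liftP_J X s : lift X (nb * nc * 2) *m JP s = JP s *m lift X (nb * nc * 1).
Proof. by rewrite -!tens11 !tensmx_mul !mulmx1 !mul1mx. Qed.

Lemma liftY_J X s : lift X (ng * 2) *m JY s = JY s *m lift X (ng * 1).
Proof. by rewrite -!tens11 !tensmx_mul !mulmx1 !mul1mx. Qed.

Definition cU h : 'M[C]_(regP 2) :=
  lift P (nb * nc * 2) *m (cRefl *m (lift (P^t*) (nb * nc * 2) *m ((Smx 2)^t* *m
    (lift (Y^t*) (ng * 2) *m (cPhi h *m (lift Y (ng * 2) *m Smx 2)))))).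

(** Conjugated by P, the reflection about [start] becomes the reflection about the synthesized
    state; the factors between Y and its adjoint give the diagonal phase D. *)
Definition walk h : 'M[C]_(regP 1) :=
  lift P (nb * nc * 1) *m (reflection start *m (lift (P^t*) (nb * nc * 1) *m ((Smx 1)^t* *m
    (lift (Y^t*) (ng * 1) *m (Phi h *m (lift Y (ng * 1) *m Smx 1)))))).

Lemma tval_cU N h t psi : tval (4 + N)%N (cU_tree h t) psi = tval N t (cU h *m psi).
Proof.
rewrite -[(4 + N)%N]/(N.+4) /cU_tree tval_pre (@tval_ask _ BoxY) tval_pre
  (@tval_ask _ BoxYdag) tval_pre (@tval_ask _ BoxPdag) tval_pre (@tval_ask _ BoxP).
by rewrite /cU !mulmxA.
Qed.

Lemma tval_cU_iter N h k t psi :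
  tval (k * 4 + N)%N (cU_iter h k t) psi = tval N t (mxpow (cU h) k *m psi).
Proof.
elim: k psi => [|k ih] psi; first by rewrite mul1mx.
rewrite mulSn -addnA tval_cU ih mulmxA; congr (tval _ _ (_ *m _)).
by rewrite -[k.+1]addn1 mxpowD /= mulmx1.
Qed.

Hypotheses (hP : isometry P) (hY : isometry Y).

Lemma coP : P *m P^t* = 1%:M. Proof. exact: mulmx1C hP. Qed.

Lemma cU_J0 h : cU h *m JP 0 = JP 0.
Proof.
rewrite /cU -!mulmxA Smx_J (mulmxA _ (JY 0)) liftY_J -!mulmxA.
rewrite (mulmxA (cPhi h)) (ctrl0 (JY_isometry 0) JY_ortho).
rewrite (mulmxA _ (JY 0)) liftY_J -!mulmxA (mulmxA (lift _ _) (lift _ _)) liftM hY lift1 mul1mx.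
rewrite (mulmxA _ (JY 0)) SmxV_J -!mulmxA Smx_isometry mulmx1.
rewrite liftP_J (mulmxA cRefl) (ctrl0 (JP_isometry 0) JP_ortho).
by rewrite mulmxA liftP_J -mulmxA liftM coP lift1 mulmx1.
Qed.

Lemma cU_J1 h : cU h *m JP 1 = JP 1 *m walk h.
Proof.
rewrite /cU -!mulmxA Smx_J (mulmxA _ (JY 1)) liftY_J -!mulmxA.
rewrite (mulmxA (cPhi h)) (ctrl1 (JY_isometry 1) JY_ortho) -!mulmxA.
rewrite (mulmxA _ (JY 1)) liftY_J -!mulmxA.
rewrite (mulmxA _ (JY 1)) SmxV_J -!mulmxA.
rewrite (mulmxA _ (JP 1)) liftP_J -!mulmxA.
rewrite (mulmxA cRefl) (ctrl1 (JP_isometry 1) JP_ortho) -!mulmxA.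
by rewrite (mulmxA _ (JP 1)) liftP_J -!mulmxA.
Qed.

Lemma lift_isometry d w (X : 'M[C]_d) : isometry X -> isometry (lift X w).
Proof.
move=> hX; apply: isometry_tens (isometry1 _ _).
exact: isometry_tens (isometry1 _ _) hX.
Qed.

Lemma walk_isometry h : isometry (walk h).
Proof.
apply: isometryM (lift_isometry _ hP) _.
apply: isometryM (reflection_isometry start1) _.
apply: isometryM (lift_isometry _ (isometry_adj hP)) _.
apply: isometryM (Smx_coisometry 1) _.
apply: isometryM (lift_isometry _ (isometry_adj hY)) _.
apply: isometryM (Phi_isometry h) _.
exact: isometryM (lift_isometry _ hY) (Smx_isometry 1).
Qed.

Lemma cU_pow_J0 h k : mxpow (cU h) k *m JP 0 = JP 0.
Proof. by elim: k => [|k ih]; rewrite ?mul1mx //= -mulmxA ih cU_J0. Qed.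

Lemma cU_pow_J1 h k : mxpow (cU h) k *m JP 1 = JP 1 *m mxpow (walk h) k.
Proof.
elim: k => [|k ih]; first by rewrite mul1mx mulmx1.
by rewrite /= -mulmxA ih mulmxA cU_J1 mulmxA.
Qed.

(** Four queries per walk step and 2^J - 1 steps in all; the query preparing the state is not
    included. *)
Fixpoint test_cost J := if J is J'.+1 then (2 ^ J' * 4 + test_cost J')%N else 0%N.

Local Notation pr := (pr rdy body P Y good).

(** Induction over the factors of the average, for an unnormalized state. Only an inequality holds:
    an early rejection leaves queries unspent, and these are given up by monotonicity in N. *)
Lemma tval_test_tree h J ka kr N phi :
  sqnorm (avg (walk h) J *m phi) * pr ka N +
    (sqnorm phi - sqnorm (avg (walk h) J *m phi)) * pr kr N <=
  tval (test_cost J + N)%N (test_tree h J ka kr) phi.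
Proof.
elim: J phi => [|J ih] phi; first by rewrite /= tval_finish mul1mx subrr mul0r addr0.
rewrite [test_tree _ _ _ _]/= tval_pre -addnA tval_cU_iter tval_meas2 tval_finish.
set chi := mxpow _ _ *m (had 1 *m phi).
have e : (had 1)^t* *m chi = ((1 / 2 : R)%:C%C *: (1%:M + mxpow (walk h) (2 ^ J))) *m phi.
  rewrite /chi (mulmxA (mxpow _ _)) mulmxA; congr (_ *m phi).
  exact: (hadamard_test (JP_isometry 0) (JP_isometry 1) JP_ortho
    (cU_pow_J0 _ _) (cU_pow_J1 _ _)).
have nchi : sqnorm ((had 1)^t* *m chi) + sqnorm ((had (-1))^t* *m chi) = sqnorm phi.
  rewrite (sqnorm_complete _ had_complete) /chi sqnorm_iso.
    exact: sqnorm_iso had_isometry.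
  apply: isometry_mxpow; rewrite /cU.
  apply: isometryM (lift_isometry _ hP) _.
  apply: isometryM cRefl_isometry _.
  apply: isometryM (lift_isometry _ (isometry_adj hP)) _.
  apply: isometryM (Smx_coisometry 2) _.
  apply: isometryM (lift_isometry _ (isometry_adj hY)) _.
  apply: isometryM (cPhi_isometry h) _.
  exact: isometryM (lift_isometry _ hY) (Smx_isometry 2).
have hm : pr kr N <= pr kr (test_cost J + N)%N by apply: pr_le => //; rewrite leq_addl.
have hm' := ler_wpM2l (sqnorm_ge0 ((had (-1))^t* *m chi)) hm.
have e2 : avg (walk h) J *m ((had 1)^t* *m chi) = avg (walk h) J.+1 *m phi.
  by rewrite e mulmxA.
have := ih ((had 1)^t* *m chi); rewrite e2 -nchi => ih'.
exact: mix_le hm' ih'.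
Qed.

Hypothesis rdyE : rdy = box_embed 1 BoxP w1 *m start.
Hypothesis bodyE : forall h J ka kr, body h J ka kr = test_body h J ka kr.

Definition synth_state : 'cV[C]_(regP 1) := lift P w1 *m start.

Lemma pr_CTest h J ka kr N :
  sqnorm (avg (walk h) J *m synth_state) * pr ka N +
    (1 - sqnorm (avg (walk h) J *m synth_state)) * pr kr N <=
  pr (CTest h J ka kr) (test_cost J + N).+1.
Proof.
have n1 : sqnorm synth_state = 1.
  by rewrite (sqnorm_iso _ (lift_isometry _ hP)) start1.
have := tval_test_tree h J ka kr N synth_state; rewrite n1 => t1.
apply: le_trans t1 _.
rewrite /pr /= rdyE mulmxA (box_box_embed BoxP) -mulmxA bodyE.
by rewrite -[prob _ _ _ _ _ _]/(tval _ _ _) tval_meas2_adj //;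
  [exact: isometry_box_embed|exact: box_embed01].
Qed.

End Circuits.

Lemma adj_sum (R : realType) m n (I : finType) (F : I -> 'M[R[i]]_(m, n)) :
  (\sum_i F i)^t* = \sum_i (F i)^t*.
Proof. by rewrite linear_sum /= map_mx_sum. Qed.

Lemma tens_ortho (R : realType) m m1 m2 n g g1 g2 t t1 t2
  (A : 'M[R[i]]_(m, m1)) (A' : 'M_(m, m2)) (G : 'M_(g, g1)) (G' : 'M_(g, g2))
  (T : 'M_(t, t1)) (T' : 'M_(t, t2)) : A^t* *m A' = 0 ->
  (((1%:M : 'M_n) *t (A *t G)) *t T)^t* *m (((1%:M : 'M_n) *t (A' *t G')) *t T') = 0.
Proof. by move=> h; rewrite !adj_tens !tensmx_mul h tens0mx tensmx0 tens0mx. Qed.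

Lemma orthonormal_dot (R : realType) n (I : finType) (b : I -> 'cV[R[i]]_n) f g :
  (forall i, isometry (b i)) -> (forall i j, i != j -> (b i)^t* *m b j = 0) ->
  (\sum_i f i *: b i)^t* *m (\sum_i g i *: b i) = (\sum_i (f i)^* * g i)%:M.
Proof.
move=> b1 bo; rewrite adj_sum mulmx_suml raddf_sum; apply: eq_bigr => i _ /=.
rewrite adjZ -scalemxAl mulmx_sumr (bigD1 i) //= -scalemxAr b1.
rewrite big1 => [|j ij]; last by rewrite -scalemxAr bo ?scaler0 // eq_sym.
by rewrite addr0 scalerA scalemx1.
Qed.

Lemma reflection_conj (R : realType) n (V : 'M[R[i]]_n) (s x : 'cV[R[i]]_n) : isometry V ->
  V *m (reflection s *m (V^t* *m x)) = reflection (V *m s) *m x.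
Proof.
move=> hV; rewrite /reflection !mulmxBl !mulmxBr !mul1mx -!scalemxAl -scalemxAr adjM !mulmxA.
by rewrite (mulmx1C hV) mul1mx.
Qed.

Lemma tens_sum_mid (R : realType) (I : finType) k n1 n2 t1 t2
  (K : 'M[R[i]]_k) (c : I -> R[i]) (F : I -> 'M_(n1, n2)) (T : 'M_(t1, t2)) :
  (K *t (\sum_i c i *: F i)) *t T = \sum_i c i *: ((K *t F i) *t T).
Proof.
apply/matrixP => i j; rewrite !mxE !summxE mulr_sumr mulr_suml; apply: eq_bigr => k' _.
by rewrite !mxE; ring.
Qed.

(** * The approximate eigenvector of the walk *)

Section Walk.
Variables (R : realType) (na ng nb nc : nat) (Omega : finType).
Local Notation C := R[i].
Local Notation dP := (na * ng)%N.
Local Notation dY := (na * nb * nc)%N.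
Local Notation w1 := (nb * nc * 1)%N.
Local Notation regP q := (1 * dP * (nb * nc * q))%N.
Local Notation regY q := (1 * dY * (ng * q))%N.

Variables (init : 'cV[C]_dP) (zb : 'I_nb) (zc : 'I_nc) (val_dec : 'I_nb -> R).
Variables (P : 'M[C]_dP) (Y : 'M[C]_dY).
Variables (p y : Omega -> R) (enc : Omega -> 'I_na) (val : Omega -> 'I_nb).
Variable garbage : Omega -> 'cV[C]_ng.
Hypotheses (p_ge0 : forall w, 0 <= p w) (p_sum : \sum_w p w = 1).
Hypotheses (enc_inj : injective enc) (valE : forall w, val_dec (val w) = y w).
Hypothesis garbage1 : forall w, sqnorm (garbage w) = 1.
Hypotheses (hP : isometry P) (hY : isometry Y).
Hypothesis Pinit :
  P *m init = \sum_w (Num.sqrt (p w))%:C%C *: tens_state (ket R (enc w)) (garbage w).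
Hypothesis Yenc : forall w,
  Y *m tens_state (tens_state (ket R (enc w)) (ket R zb)) (ket R zc) =
  tens_state (tens_state (ket R (enc w)) (ket R (val w))) (ket R zc).

Definition branch w : 'cV[C]_(regP 1) :=
  ((1%:M : 'M_1) *t (ket R (enc w) *t garbage w)) *t ((ket R zb *t ket R zc) *t (1%:M : 'M_1)).

Definition branchY w v : 'cV[C]_(regY 1) :=
  ((1%:M : 'M_1) *t ((ket R (enc w) *t ket R v) *t ket R zc)) *t (garbage w *t (1%:M : 'M_1)).

(** The walk preserves the span of the orthonormal vectors [branch w], so all computations take
    place on coefficient functions and the garbage disappears. *)
Definition vec (f : Omega -> C) : 'cV[C]_(regP 1) := \sum_w f w *: branch w.

Lemma branch_isometry w : isometry (branch w).
Proof.
exact: (isometry_tens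
  (isometry_tens (isometry1 _ 1)
    (isometry_tens (isometry_ket R (enc w)) (isometry_vec (garbage1 w))))
  (isometry_tens (isometry_tens (isometry_ket R zb) (isometry_ket R zc)) (isometry1 _ 1))).
Qed.

Lemma branch_ortho w w' : w != w' -> (branch w)^t* *m branch w' = 0.
Proof.
move=> ww'; have k : (ket R (enc w))^t* *m ket R (enc w') = 0.
  by apply: ket_ortho; rewrite (inj_eq enc_inj).
exact (tens_ortho 1 (garbage w) (garbage w')
  ((ket R zb *t ket R zc) *t (1%:M : 'M_1)) ((ket R zb *t ket R zc) *t (1%:M : 'M_1)) k).
Qed.

Lemma vec_dot f g : (vec f)^t* *m vec g = (\sum_w (f w)^* * g w)%:M.
Proof. exact: orthonormal_dot branch_isometry branch_ortho. Qed.

Lemma Smx_branch w : Smx R na ng nb nc 1 *m branch w = branchY w zb.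
Proof.
have := shuffle_mx_tens (1%:M : 'M[C]_1) (ket R (enc w)) (garbage w)
  (ket R zb) (ket R zc) (1%:M : 'M_1).
by rewrite (shuffle_mx11 R) mulmx1.
Qed.

Lemma Y_branch w :
  (((1%:M : 'M[C]_1) *t Y) *t (1%:M : 'M_(ng * 1))) *m branchY w zb = branchY w (val w).
Proof.
have := tensmx_mul ((1%:M : 'M[C]_1) *t Y) (1%:M : 'M_(ng * 1))
  ((1%:M : 'M_1) *t ((ket R (enc w) *t ket R zb) *t ket R zc)) (garbage w *t (1%:M : 'M_1)).
have := tensmx_mul (1%:M : 'M[C]_1) Y (1%:M : 'M_1)
  ((ket R (enc w) *t ket R zb) *t ket R zc).
rewrite (Yenc w) mulmx1 mul1mx => -> ->; rewrite //.
Qed.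

Lemma phases_ket h v :
  phases val_dec h *m ket R v = cayley (h (val_dec v)) *: ket R v.
Proof.
rewrite /phases mul_diag_mx; apply/matrixP => i j; rewrite !mxE.
by case: eqP => [->|_]; rewrite ?mulr0.
Qed.

Lemma Phi_branch h w :
  Phi na ng nc val_dec h *m branchY w (val w) = cayley (h (y w)) *: branchY w (val w).
Proof.
have e1 := tensmx_mul ((1%:M : 'M[C]_1) *t (((1%:M : 'M_na) *t phases val_dec h) *t (1%:M : 'M_nc)))
  (1%:M : 'M_(ng * 1))
  ((1%:M : 'M_1) *t ((ket R (enc w) *t ket R (val w)) *t ket R zc)) (garbage w *t (1%:M : 'M_1)).
have e2 := tensmx_mul (1%:M : 'M[C]_1) (((1%:M : 'M_na) *t phases val_dec h) *t (1%:M : 'M_nc))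
  (1%:M : 'M_1) ((ket R (enc w) *t ket R (val w)) *t ket R zc).
have e3 := tensmx_mul ((1%:M : 'M_na) *t phases val_dec h) (1%:M : 'M_nc)
  (ket R (enc w) *t ket R (val w)) (ket R zc).
have e4 := tensmx_mul (1%:M : 'M_na) (phases val_dec h) (ket R (enc w)) (ket R (val w)).
rewrite phases_ket valE !mul1mx tensmxZr in e4.
rewrite e4 mul1mx tensmxZl in e3.
rewrite e3 mul1mx tensmxZr in e2.
rewrite e2 mul1mx tensmxZl in e1.
exact: e1.
Qed.

Section Eigenrelation.
Variable h : R -> R.
Let z w := h (y w).
Let m : R := \sum_w p w * z w.

Definition phase_step (x : 'cV[C]_(regP 1)) : 'cV[C]_(regP 1) :=
  (Smx R na ng nb nc 1)^t* *m ((((1%:M : 'M[C]_1) *t (Y^t*)) *t (1%:M : 'M_(ng * 1))) *m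
   (Phi na ng nc val_dec h *m ((((1%:M : 'M[C]_1) *t Y) *t (1%:M : 'M_(ng * 1))) *m
    (Smx R na ng nb nc 1 *m x)))).

(** Y writes the value of w, the phase is read off it, and the adjoint of Y erases it: each branch
    is an eigenvector. *)
Lemma phase_step_branch w : phase_step (branch w) = cayley (z w) *: branch w.
Proof.
rewrite /phase_step Smx_branch Y_branch Phi_branch -!scalemxAr -Y_branch.
have e := isometryK (branchY w zb) (lift_isometry (ng * 1) hY).
rewrite !adj_tens !adj1 in e; rewrite e -Smx_branch.
by rewrite (isometryK _ (@Smx_isometry R na ng nb nc 1)).
Qed.

Lemma phase_step_vec f : phase_step (vec f) = vec (fun w => cayley (z w) * f w).
Proof.
rewrite /phase_step /vec !mulmx_sumr; apply: eq_bigr => w _.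
rewrite [cayley _ * _]mulrC -scalerA -phase_step_branch /phase_step.
by rewrite -!scalemxAr.
Qed.

Local Notation walk := (walk init zb zc val_dec P Y).

Lemma walkE x : walk h *m x =
  reflection (synth_state init zb zc P) *m phase_step x.
Proof.
rewrite -(reflection_conj _ _ (lift_isometry _ hP)) !adj_tens !adj1.
by rewrite /walk /phase_step !mulmxA.
Qed.

Lemma synth_stateE : synth_state init zb zc P = vec (fun w => (Num.sqrt (p w))%:C%C).
Proof.
have e1 := tensmx_mul ((1%:M : 'M[C]_1) *t P) (1%:M : 'M_w1)
  ((1%:M : 'M_1) *t init) ((ket R zb *t ket R zc) *t (1%:M : 'M_1)).
have e2 := tensmx_mul (1%:M : 'M[C]_1) P (1%:M : 'M_1) init.
rewrite Pinit mul1mx in e2; rewrite e2 mul1mx in e1.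
apply: etrans e1 _; exact: tens_sum_mid.
Qed.

Definition eigvec := vec (fun w => (Num.sqrt (p w))%:C%C * Complex 1 (- z w)).

Lemma sqrt_p2 w : (Num.sqrt (p w))%:C%C^* * (Num.sqrt (p w))%:C%C = (p w)%:C%C.
Proof. by rewrite conjCc conjc_real -rmorphM /= -expr2 sqr_sqrtr. Qed.

Lemma conj_sqrtM w (s t : C) :
  ((Num.sqrt (p w))%:C%C * s)^* * ((Num.sqrt (p w))%:C%C * t) = (p w)%:C%C * (s^* * t).
Proof. by rewrite rmorphM /= mulrACA sqrt_p2. Qed.

(** The phases turn 1 - i z into 1 + i z, whose product with psi is 1 + i m. The reflection then
    gives 2 (1 + i m) psi - (1 + i z) psi = (1 - i z) psi + 2 i m psi. *)
Lemma walk_eigvec : walk h *m eigvec =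
  eigvec + Complex 0 (2 * m) *: synth_state init zb zc P.
Proof.
rewrite walkE phase_step_vec synth_stateE /reflection mulmxBl mul1mx -scalemxAl -mulmxA.
have -> : vec (fun w => cayley (z w) * ((Num.sqrt (p w))%:C%C * Complex 1 (- z w))) =
   vec (fun w => (Num.sqrt (p w))%:C%C * Complex 1 (z w)).
  by apply: eq_bigr => w _; rewrite mulrCA cayleyE.
rewrite vec_dot.
have -> : \sum_w (Num.sqrt (p w))%:C%C^* * ((Num.sqrt (p w))%:C%C * Complex 1 (z w)) =
   Complex 1 m.
  have -> : Complex 1 m = \sum_w (p w)%:C%C * Complex 1 (z w).
    apply/eqP; rewrite eq_complex !raddf_sum /=; apply/andP; split; apply/eqP.
      by rewrite -[LHS]p_sum; apply: eq_bigr => w _; ring.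
    by apply: eq_bigr => w _; ring.
  by apply: eq_bigr => w _; rewrite mulrA sqrt_p2.
rewrite mul_mx_scalar scalerA /eigvec /vec.
rewrite !scaler_sumr -big_split -sumrB; apply: eq_bigr => w _ /=.
rewrite !scalerA -scalerDl -scalerBl; congr (_ *: _).
by apply/eqP; rewrite eq_complex /=; apply/andP; split; apply/eqP; ring.
Qed.

Lemma rdot_eigvec : rdot eigvec (synth_state init zb zc P) = 1.
Proof.
rewrite /rdot synth_stateE vec_dot mxE eqxx mulr1n raddf_sum -[RHS]p_sum.
apply: eq_bigr => w _; rewrite -[X in _ * X]mulr1 conj_sqrtM conjCc /=; ring.
Qed.

Lemma sqnorm_eigvec : sqnorm eigvec = 1 + \sum_w p w * z w ^+ 2.
Proof.
rewrite sqnormE /rdot vec_dot mxE eqxx mulr1n raddf_sum -[X in _ = X + _]p_sum -big_split.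
apply: eq_bigr => w _; rewrite conj_sqrtM conjCc /=; ring.
Qed.

End Eigenrelation.
End Walk.

(** * The control program *)

(** Query budget of [search_prog] from level i on, for grids of g points: 16 + rem votes per point,
    each a test of cost 4 * 2^(i + 8). *)
Fixpoint scan_cost g rem i :=
  if rem is rem'.+1 then
    (g * ((16 + rem) * (4 * 2 ^ (i + 8))) + scan_cost g rem' i.+1)%N
  else 0%N.

(** Test costs double from level to level while the number of votes decreases linearly, so the last
    levels dominate. *)
Lemma scan_cost_le g : exists K, forall rem i, (scan_cost g rem i <= K * 2 ^ (i + rem))%N.
Proof.
pose t := (2 ^ 8)%N; exists (g * (4 * t) * 18)%N => rem i.
(* The added term closes the induction without loss, since (17 + rem) + (rem + 19) = 2 (rem +
   18). *)
suff : (scan_cost g rem i + g * (4 * t) * (2 ^ i * (rem + 18)) <=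
    g * (4 * t) * 18 * 2 ^ (i + rem))%N by apply: leq_trans; exact: leq_addr.
elim: rem i => [|rem ih] i.
  by rewrite [scan_cost _ _ _]/= addn0 !add0n -!mulnA [(18 * _)%N]mulnC.
have {ih} := ih i.+1; rewrite [scan_cost _ _.+1 _]/= addSnnS (expnD 2 i 8) (expnS 2 i) -/t.
clearbody t.
move: (scan_cost _ _ _) (2 ^ (i + rem.+1))%N (2 ^ i)%N => x z w.
have -> : (g * (4 * t) * (2 * w * (rem + 18)) = g * t * w * (8 * (rem + 18)))%N by lia.
have -> : (g * ((16 + rem.+1) * (4 * (w * t))) = g * t * w * (4 * (17 + rem)))%N by lia.
have -> : (g * (4 * t) * (w * (rem.+1 + 18)) = g * t * w * (4 * (rem + 19)))%N by lia.
have -> : (g * (4 * t) * 18 * z = g * t * 18 * 4 * z)%N by lia.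
move: (g * t * w)%N (g * t * 18 * 4 * z)%N => u v; lia.
Qed.

Section Programs.
Variable R : realType.

(* Finds [E (h y)] up to a constant factor, as [4 ^- j]. *)
CoFixpoint loop_prog (h : R -> R) (k : nat -> program R) j : program R :=
  CTest (fun x => 2 ^+ j * h x) j (loop_prog h k j.+1) (k j).

(** [a] counts the acceptances and [b] the rejections so far; a tie rejects. *)
Fixpoint vote_prog (h : R -> R) J n a b (ka kr : program R) : program R :=
  if n is n'.+1 then CTest h J (vote_prog h J n' a.+1 b ka kr) (vote_prog h J n' a b.+1 ka kr)
  else if (b < a)%N then ka else kr.

(** The first point to win its vote is kept. Running out of points is a failure, where 0 is an
    arbitrary output. *)
Fixpoint scan_prog (h : R -> R -> R) J n (pts : seq R) (k : R -> program R) : program R :=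
  if pts is s :: pts' then vote_prog (h s) J n 0 0 (k s) (scan_prog h J n pts' k)
  else COut 0.

(** The points cover [s - r, s + r]; their step r / 2^10 is the distance up to which a test accepts
    with high probability. *)
Definition grid (s r : R) : seq R :=
  [seq s - r + j%:R * (r / 2 ^+ 10) | j <- iota 0 (2 ^ 11).+1].

(* The level i halves the error [st / 2 ^ i].  It is followed by [rem'] others: its
   number of votes makes its failure probability O(2 ^- rem'), while the costs of
   all the levels add up to O(2 ^ (i + rem')). *)
Fixpoint search_prog rem i (st s : R) (k : R -> program R) : program R :=
  if rem is rem'.+1 then
    scan_prog (fun s' x => (x - s') / (16 * st)) (i + 8) (16 + rem) (grid s (st / 2 ^+ i))
      (fun s' => search_prog rem' i.+1 st s' k)
  else k s.

(** For 0 < eps < 1, [2 ^ digits eps] is 1 / sqrt eps up to a factor 2. *)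
Definition digits (eps : R) : nat := (trunc_log 4 (Num.truncn (1 / eps))).+1.

(* [4 ^- j1] is of the order of mu, then [|mu - s| <= sqrt (eps * mu)], then
   [4 ^- j3] is of the order of sigma ^ 2 + eps * mu. *)
Definition mean_prog (eps : R) : program R :=
  if 1 <= eps then COut 0 else
  loop_prog id (fun j1 =>
    search_prog (digits eps + 8) 0 (16 / 2 ^+ j1) 0 (fun s =>
      loop_prog (fun x => ((x - s) ^+ 2 + 1 / 4 ^+ (digits eps + j1)) / 4) (fun j3 =>
        search_prog (2 * (digits eps + j1) + 13 - j3) 0 (32 / 2 ^+ j3) s (@COut R)) 0)) 0.

Lemma digitsP eps : 0 < eps -> eps < 1 -> 1 <= 4 ^+ digits eps * eps <= 4.
Proof.
move=> e0 e1; rewrite /digits; set t := Num.truncn _.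
have i0 : 0 <= 1 / eps by rewrite divr_ge0 // ltW.
have /andP[t1 t2] := truncn_itv i0; rewrite -/t in t1 t2.
have tpos : (0 < t)%N.
  by rewrite truncn_ge_nat // ler_pdivlMr // mul1r ltW.
have /andP[l1 l2] := trunc_log_bounds (isT : (1 < 4)%N) tpos.
rewrite ler_pdivlMr // in t1; rewrite ltr_pdivrMr // in t2.
have h1 : t%:R + 1 <= 4 ^+ (trunc_log 4 t).+1 :> R by rewrite natr1 -natrX ler_nat.
have h2 : 4 ^+ trunc_log 4 t <= t%:R :> R by rewrite -natrX ler_nat.
apply/andP; split.
  by apply: ltW; apply: lt_le_trans t2 _; rewrite -natr1 ler_wpM2r // ltW.
rewrite exprS -mulrA -[X in _ <= X]mulr1 ler_pM2l //; apply: le_trans t1.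
by rewrite ler_wpM2r // ltW.
Qed.

Lemma loop_progE h k j :
  loop_prog h k j = CTest (fun x => 2 ^+ j * h x) j (loop_prog h k j.+1) (k j).
Proof.
rewrite -[LHS]/(loop_prog h k j).
have frob (c : program R) : 
    c = match c with COut r => COut r | CTest h J ka kr => CTest h J ka kr end.
  by case: c.
by rewrite [LHS]frob.
Qed.

(** * Classical analysis of the programs: the loop *)

Variables (Omega : finType) (p y : Omega -> R) (pr : program R -> nat -> R).
Local Notation E f := (\sum_w p w * f w).

Hypotheses (p_ge0 : forall w, 0 <= p w) (p_sum : \sum_w p w = 1).
Hypotheses (y01 : forall w, 0 <= y w <= 1).
Hypothesis pr_ge0 : forall c N, 0 <= pr c N.
Hypothesis pr_le : forall c N N', (N <= N')%N -> pr c N <= pr c N'.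

(** The interface with the quantum part: two bounds on the acceptance probability q, and the law of
    total probability at a cost of 4 * 2^J queries. *)
Definition test_spec h J (q : R) :=
  [/\ 0 <= q <= 1,
      (E (fun w => h (y w))) ^+ 2 * 4 ^+ J * q <= 1 + E (fun w => h (y w) ^+ 2),
      `|E (fun w => h (y w))| * 2 ^+ J <= 1 ->
        (1 - `|E (fun w => h (y w))| * 2 ^+ J) ^+ 2 <= (1 + E (fun w => h (y w) ^+ 2)) * q &
      forall ka kr N, q * pr ka N + (1 - q) * pr kr N <= pr (CTest h J ka kr) (4 * 2 ^ J + N)%N].

Hypothesis testP : forall h J, exists q, test_spec h J q.

Lemma E_ge0 f : (forall w, 0 <= f w) -> 0 <= E f.
Proof. by move=> hf; apply: sumr_ge0 => w _; rewrite mulr_ge0. Qed.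

Lemma E_le f g : (forall w, f w <= g w) -> E f <= E g.
Proof. by move=> hf; apply: ler_sum => w _; rewrite ler_wpM2l. Qed.

Lemma E_D f g : E (fun w => f w + g w) = E f + E g.
Proof. by rewrite -big_split; apply: eq_bigr => w _; rewrite mulrDr. Qed.

Lemma E_Z a f : E (fun w => a * f w) = a * E f.
Proof. by rewrite mulr_sumr; apply: eq_bigr => w _; rewrite mulrCA. Qed.

Lemma E_cst a : E (fun=> a) = a.
Proof. by rewrite -mulr_suml p_sum mul1r. Qed.

(** Take the least J with 64 <= 4^J q: minimality gives 4^J q < 4 * 64. At this level the loop is
    very likely to stop. *)
Lemma scale_level (q : R) : 0 < q -> q <= 1 ->
  exists J, 64 <= 4 ^+ J * q <= 2 ^+ 8.
Proof.
move=> q0 q1.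
have [n hn] : exists n, 64 <= 4 ^+ n * q.
  exists (Num.Def.archi_bound (64 / q)).
  rewrite -ler_pdivrMr //; apply: ltW; apply: lt_le_trans (archi_boundP _) _.
    by rewrite divr_ge0 // ltW.
  by rewrite -natrX ler_nat; apply: ltnW; apply: ltn_expl.
have /ex_minnP [J hJ Jmin] : exists n, 64 <= 4 ^+ n * q by exists n.
exists J; rewrite hJ /=; case: J hJ Jmin => [|J] hJ Jmin; first by move: hJ; rewrite expr0; lra.
have : ~~ (64 <= 4 ^+ J * q) by apply/negP => /Jmin; rewrite ltnn.
by rewrite -ltNge exprS; lra.
Qed.

Fixpoint loop_cost i j := (4 * 2 ^ j + if i is i'.+1 then loop_cost i' j.+1 else 0)%N.

Lemma loop_costE i j : (loop_cost i j + 4 * 2 ^ j = 8 * 2 ^ (i + j))%N.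
Proof.
elim: i j => [|i ih] j /=; first by rewrite addn0 add0n; lia.
by have := ih j.+1; rewrite addnS addSn !expnS; lia.
Qed.

(** Success means stopping at a j with 4^j q in [2^-8, 2^8]. Below this window a rejection has
    probability at most 3 * 4^j q, so the losses form a geometric series; inside it any stop is
    welcome; level J rejects with probability at least 31/32. *)
Lemma loop_ok h k (q c : R) J N :
  (forall w, 0 <= h (y w) <= 1) -> q = E (fun w => h (y w)) -> 0 <= c ->
  64 <= 4 ^+ J * q <= 2 ^+ 8 ->
  (forall j, 1 / 2 ^+ 8 <= 4 ^+ j * q <= 2 ^+ 8 -> c <= pr (k j) N) ->
  15 / 16 * c <= pr (loop_prog h k 0) (8 * 2 ^ J + N).
Proof.
move=> h01 qE c0 /andP[J64 J256] hk.
have q0 : 0 <= q by rewrite qE; apply: E_ge0 => w; case/andP: (h01 w).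
have q1 : q <= 1.
  by rewrite qE -(E_cst 1); apply: E_le => w; case/andP: (h01 w).
have fact j : exists2 Q, 0 <= Q <= 1 & [/\ (4 ^+ j * q) ^+ 2 * Q <= 1 + 4 ^+ j * q,
    4 ^+ j * q <= 1 -> 1 - 3 * (4 ^+ j * q) <= Q &
    forall ka kr N, Q * pr ka N + (1 - Q) * pr kr N <=
      pr (CTest (fun x => 2 ^+ j * h x) j ka kr) (4 * 2 ^ j + N)%N].
  have [Q [Q01 up lo hQ]] := testP (fun x => 2 ^+ j * h x) j.
  exists Q => //; move: up lo.
  rewrite E_Z -qE.
  have e4 : 2 ^+ j * 2 ^+ j = 4 ^+ j :> R by rewrite -exprMn; congr (_ ^+ _); ring.
  have -> : `|2 ^+ j * q| * 2 ^+ j = 4 ^+ j * q.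
    by rewrite ger0_norm ?mulr_ge0 ?exprn_ge0 // mulrAC e4.
  have -> : (2 ^+ j * q) ^+ 2 * 4 ^+ j = (4 ^+ j * q) ^+ 2 by rewrite -e4; ring.
  (* As h takes values in [0, 1], h^2 <= h bounds the second moment of 2^j h by 4^j q. *)
  have hb : E (fun w => (2 ^+ j * h (y w)) ^+ 2) <= 4 ^+ j * q.
    rewrite qE -E_Z; apply: E_le => w.
    have /andP[hw0 hw1] := h01 w.
    rewrite exprMn expr2 e4 ler_wpM2l ?exprn_ge0 //.
    by rewrite expr2 ler_piMl.
  have b0 : 0 <= E (fun w => (2 ^+ j * h (y w)) ^+ 2) by apply: E_ge0 => w; rewrite sqr_ge0.
  have r0 : 0 <= 4 ^+ j * q by rewrite mulr_ge0 // exprn_ge0.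
  move: hb b0 r0; move: (E (fun w => (2 ^+ j * h (y w)) ^+ 2)) (4 ^+ j * q) Q01.
  move=> B r /andP[Q0 Q1] hb b0 r0 up lo.
  split => //; first by nra.
  move=> r1; have := lo r1 => {}lo.
  have : (1 - r) ^+ 2 <= (1 + r) * Q by nra.
  by move=> h2; nra.
(* Backward induction from level J, with r = 4^j q. Below the window the factor 1 + 2 r accounts for
   early rejections: (1 - 3 r) (1 + 8 r) >= 1 + 2 r for r <= 1/8. On entering the window, 15/16 (1 +
   8 r) <= 31/32. *)
suff main i j : (i + j = J)%N ->
   (if 4 ^+ j * q < 1 / 2 ^+ 8 then 15 / 16 * (1 + 2 * (4 ^+ j * q)) * c else 31 / 32 * c)
     <= pr (loop_prog h k j) (loop_cost i j + N).
  have := main J 0%N (addn0 J); rewrite expr0 mul1r => h1.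
  apply: le_trans (le_trans h1 _); first by case: ifP => _; nra.
  by apply: pr_le; rewrite leq_add2r -[J in (8 * 2 ^ J)%N]addn0 -loop_costE leq_addr.
have r0 l : 0 <= 4 ^+ l * q by rewrite mulr_ge0 // exprn_ge0.
elim: i j => [|i ih] j ijJ; rewrite loop_progE; have [Q /andP[Q0 Q1] [up lo hQ]] := fact j.
  rewrite add0n in ijJ; rewrite ijJ in up lo hQ *; rewrite /= addn0.
  have hkJ : c <= pr (k J) N by apply: hk; rewrite J256 andbT; lra.
  apply: le_trans (hQ _ _ _); rewrite ltNge.
  have -> : 1 / 2 ^+ 8 <= 4 ^+ J * q by lra.
  have : Q <= 1 / 32.
    move: J64 up; move: (4 ^+ J * q) => r r64 up.
    rewrite -subr_le0 -(@pmulr_rle0 _ (r ^+ 2)); last by rewrite exprn_gt0 //; lra.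
    have : 64 * r <= r ^+ 2 by rewrite expr2 ler_wpM2r //; lra.
    by rewrite mulrBr => ?; lra.
  move=> Q32 /=; have := mulr_ge0 Q0 (pr_ge0 (loop_prog h k J.+1) N).
  have Q1' : 0 <= 1 - Q by lra.
  have := ler_wpM2l Q1' hkJ; move=> *; nra.
have {}ih := ih j.+1; rewrite addnS in ih; have {}ih := ih ijJ.
rewrite /= -addnA; apply: le_trans (hQ _ _ _).
rewrite exprS -mulrA in ih.
have rj := r0 j; have rJ : 4 ^+ j * q <= 2 ^+ 8.
  apply: le_trans J256; rewrite ler_wpM2r // ler_eXn2l ?ltr1n //; first by rewrite -ijJ leq_addl.
have kk : 1 / 2 ^+ 8 <= 4 ^+ j * q -> c <= pr (k j) (loop_cost i j.+1 + N).
  by move=> h1; apply: le_trans (hk _ _) (pr_le _ (leq_addl _ _)); rewrite h1.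
have := pr_ge0 (k j) (loop_cost i j.+1 + N).
move: (pr _ _) (pr _ _) (4 ^+ j * q) rj rJ kk lo ih => A B r rj rJ kk lo ih B0.
case: (ltP r (1 / 2 ^+ 8)) ih => h1 ih.
  have hQ1 : 1 - 3 * r <= Q by apply: lo; lra.
  have hA : 15 / 16 * (1 + 8 * r) * c <= A.
    by apply: le_trans ih; case: ifP => _; nra.
  have e1 : 15 / 16 * (1 + 2 * r) <= Q * (15 / 16 * (1 + 8 * r)) by nra.
  have := ler_wpM2r c0 e1; have := ler_wpM2l Q0 hA => *; nra.
have := kk h1; have : 31 / 32 * c <= A by move: ih; case: ifP => // *; lra.
move=> *; nra.
Qed.

(** * Majority votes and scans of a list of points *)

Section Vote.
Variables (h : R -> R) (J : nat) (Q : R).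
Hypothesis Q01 : 0 <= Q <= 1.
Hypothesis hQ : forall ka kr N,
  Q * pr ka N + (1 - Q) * pr kr N <= pr (CTest h J ka kr) (4 * 2 ^ J + N)%N.
Variables (ka kr : program R) (N : nat) (c : R).
Hypothesis c0 : 0 <= c.

Lemma pow_half_ge0 n : 0 <= (1 / 2 : R) ^+ n.
Proof. by rewrite exprn_ge0 //; lra. Qed.

(* [4 ^ (b - a) / 2 ^ n] bounds the probability that n more votes turn a to b
   into a minority, because [Q / 4 + 4 (1 - Q) <= 1 / 2] for [Q >= 16 / 17]. *)
Lemma vote_good_aux n a b : 16 / 17 <= Q -> c <= pr ka N ->
  c * (1 - 4 ^+ b / 4 ^+ a * (1 / 2) ^+ n) <= pr (vote_prog h J n a b ka kr) (n * (4 * 2 ^ J) + N).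
Proof.
move=> Q1 hc; elim: n a b => [|n ih] a b /=.
  rewrite add0n expr0 mulr1; have hab : 0 <= (4 : R) ^+ b / 4 ^+ a.
    by rewrite divr_ge0 // exprn_ge0.
  case: ltnP => ab; first by apply: le_trans hc; rewrite ler_piMr // gerBl.
  apply: le_trans (pr_ge0 _ _); rewrite mulr_ge0_le0 // subr_le0.
  by rewrite ler_pdivlMr ?exprn_gt0 // mul1r ler_eXn2l // ltr1n.
rewrite mulSn -addnA; apply: le_trans (hQ _ _ _).
have := ih a.+1 b; have := ih a b.+1.
rewrite !exprS invfM !mulrA [_ / 4]mulrC.
have := mulr_ge0 (divr_ge0 (exprn_ge0 b (ler0n R 4)) (exprn_ge0 a (ler0n R 4))) (pow_half_ge0 n).
move: (4 ^+ b) (4 ^+ a)^-1 ((1 / 2) ^+ n) (pr _ _) (pr _ _) => u v w A B uvw hA hB.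
have /andP[Q0 Q1'] := Q01; have Q2 : 0 <= 1 - Q by lra.
have h1 := ler_wpM2l Q0 hB; have h2 := ler_wpM2l Q2 hA.
have e : 0 <= u * v * w * c * (1 / 2 - (Q / 4 + 4 * (1 - Q))).
  by apply: mulr_ge0 (mulr_ge0 uvw c0) _; lra.
nra.
Qed.

Lemma vote_bad_aux n a b : Q <= 1 / 17 -> c <= pr kr N ->
  c * (1 - 4 ^+ a / 4 ^+ b * (1 / 2) ^+ n) <= pr (vote_prog h J n a b ka kr) (n * (4 * 2 ^ J) + N).
Proof.
move=> Q1 hc; elim: n a b => [|n ih] a b /=.
  rewrite add0n expr0 mulr1; have hab : 0 <= (4 : R) ^+ a / 4 ^+ b.
    by rewrite divr_ge0 // exprn_ge0.
  case: ltnP => ab; last by apply: le_trans hc; rewrite ler_piMr // gerBl.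
  apply: le_trans (pr_ge0 _ _); rewrite mulr_ge0_le0 // subr_le0.
  by rewrite ler_pdivlMr ?exprn_gt0 // mul1r ler_eXn2l ?ltr1n // ltnW.
rewrite mulSn -addnA; apply: le_trans (hQ _ _ _).
have := ih a.+1 b; have := ih a b.+1.
rewrite !exprS invfM !mulrA [_ / 4]mulrC.
have := mulr_ge0 (divr_ge0 (exprn_ge0 a (ler0n R 4)) (exprn_ge0 b (ler0n R 4))) (pow_half_ge0 n).
move: (4 ^+ a) (4 ^+ b)^-1 ((1 / 2) ^+ n) (pr _ _) (pr _ _) => u v w A B uvw hA hB.
have /andP[Q0 Q1'] := Q01; have Q2 : 0 <= 1 - Q by lra.
have h1 := ler_wpM2l Q0 hB; have h2 := ler_wpM2l Q2 hA.
have e : 0 <= u * v * w * c * (1 / 2 - ((1 - Q) / 4 + 4 * Q)).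
  by apply: mulr_ge0 (mulr_ge0 uvw c0) _; lra.
nra.
Qed.

Lemma vote_good n : 16 / 17 <= Q -> c <= pr ka N ->
  c * (1 - (1 / 2) ^+ n) <= pr (vote_prog h J n 0 0 ka kr) (n * (4 * 2 ^ J) + N).
Proof. by move=> hq hc; have := vote_good_aux n 0 0 hq hc; rewrite !expr0 divr1 mul1r. Qed.

Lemma vote_bad n : Q <= 1 / 17 -> c <= pr kr N ->
  c * (1 - (1 / 2) ^+ n) <= pr (vote_prog h J n 0 0 ka kr) (n * (4 * 2 ^ J) + N).
Proof. by move=> hq hc; have := vote_bad_aux n 0 0 hq hc; rewrite !expr0 divr1 mul1r. Qed.

(** For a point in between, where Q is not controlled, both continuations serve equally well. *)
Lemma vote_any n a b : c <= pr ka N -> c <= pr kr N ->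
  c <= pr (vote_prog h J n a b ka kr) (n * (4 * 2 ^ J) + N).
Proof.
move=> ha hr; elim: n a b => [|n ih] a b /=; first by rewrite add0n; case: ifP.
rewrite mulSn -addnA; apply: le_trans (hQ _ _ _).
have := ih a.+1 b; have := ih a b.+1; case/andP: Q01.
move: (pr _ _) (pr _ _) => A B Q0 Q1 hA hB.
have Q2 : 0 <= 1 - Q by lra.
have h1 := ler_wpM2l Q0 hB; have h2 := ler_wpM2l Q2 hA; lra.
Qed.
End Vote.

(** A good point wins its vote and a point that is not ok loses it, each except with probability
    2^-n; for the others either result serves. The good point in the list ends the scan, and a union
    bound gives the loss. *)
Lemma scan_ok (h : R -> R -> R) J n pts k N c (ok good : pred R) :
  0 <= c ->
  (forall s, exists2 q, 0 <= q <= 1 &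
    [/\ good s -> 16 / 17 <= q, ~~ ok s -> q <= 1 / 17 &
      forall ka kr N, q * pr ka N + (1 - q) * pr kr N <=
        pr (CTest (h s) J ka kr) (4 * 2 ^ J + N)%N]) ->
  (forall s, good s -> ok s) ->
  (exists2 s, s \in pts & good s) ->
  (forall s, ok s -> c <= pr (k s) N) ->
  c * (1 - (size pts)%:R * (1 / 2) ^+ n) <=
    pr (scan_prog h J n pts k) (size pts * (n * (4 * 2 ^ J)) + N).
Proof.
move=> c0 hh good_ok + hk; elim: pts => [|s pts ih] [t tin gt]; first by rewrite in_nil in tin.
have [q q01 [qgood qbad hq]] := hh s.
rewrite [scan_prog _ _ _ _ _]/= [size _]/= mulSn -addnA.
set N' := (_ + N)%N; have f0 := pow_half_ge0 n.
have sf0 : 0 <= (size pts)%:R * (1 / 2) ^+ n * c :> R by rewrite !mulr_ge0.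
have hkN s' : ok s' -> c <= pr (k s') N'.
  by move=> /hk h1; apply: le_trans h1 (pr_le _ (leq_addl _ _)).
rewrite -natr1; case gs : (good s).
  have := vote_good q01 hq (N := N') (scan_prog h J n pts k) c0 n (qgood gs) (hkN _ (good_ok _ gs)).
  by apply: le_trans; nra.
have {}ih : c * (1 - (size pts)%:R * (1 / 2) ^+ n) <= pr (scan_prog h J n pts k) N'.
  apply: ih; exists t => //; move: tin; rewrite inE => /orP[/eqP ts|//].
  by rewrite -ts gt in gs.
have fc : 0 <= c * (1 / 2) ^+ n by rewrite mulr_ge0.
(* The vote lemmas need a nonnegative bound; when the union bound exceeds 1 there is nothing to
   prove. *)
have [c'0|c'0] := leP 0 (c * (1 - (size pts)%:R * (1 / 2) ^+ n)); last first.
  by apply: le_trans (pr_ge0 _ _); nra.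
case oks : (ok s).
  have hc : c * (1 - (size pts)%:R * (1 / 2) ^+ n) <= pr (k s) N'.
    by apply: le_trans (hkN _ oks); nra.
  have := vote_any q01 hq n 0 0 hc ih.
  by apply: le_trans; nra.
have := vote_bad q01 hq (N := N') (k s) c'0 n (qbad (negbT oks)) ih.
apply: le_trans.
have fs : 0 <= (1 / 2) ^+ n * ((size pts)%:R * (1 / 2) ^+ n * c) by rewrite mulr_ge0.
nra.
Qed.

(** * The search for mu on finer and finer grids *)

Local Notation search_cost := (scan_cost (2 ^ 11).+1).
Local Notation mu := (E y).
Local Notation V := (E (fun w => (y w - mu) ^+ 2)).

Lemma E_sq s : E (fun w => (y w - s) ^+ 2) = V + (mu - s) ^+ 2.
Proof.
have -> : E (fun w => (y w - s) ^+ 2) =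
    E (fun w => (y w - mu) ^+ 2 + (2 * (mu - s) * (y w - mu) + (mu - s) ^+ 2)).
  by apply: eq_bigr => w _; ring.
rewrite E_D E_D E_Z E_cst.
have -> : E (fun w => y w - mu) = 0 by rewrite E_D E_cst subrr.
by rewrite mulr0 add0r.
Qed.

(** On [0, 1] one has y^2 <= y, and V is at most the second moment. *)
Lemma V_le_mu : V <= mu.
Proof.
have := E_sq 0; rewrite subr0 => h.
have : E (fun w => (y w - 0) ^+ 2) <= mu.
  apply: E_le => w; have /andP[h0 h1] := y01 w.
  by rewrite subr0 expr2 ler_piMl.
by have := sqr_ge0 mu; move=> *; lra.
Qed.

Lemma V_ge0 : 0 <= V.
Proof. by apply: E_ge0 => w; rewrite sqr_ge0. Qed.

Lemma search_progS rem i st s k : search_prog rem.+1 i st s k =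
  scan_prog (fun s' x => (x - s') / (16 * st)) (i + 8) (16 + rem.+1) (grid s (st / 2 ^+ i))
      (fun s' => search_prog rem i.+1 st s' k).
Proof. by []. Qed.

(** D is the offset (mu - s') / st, w the scale 2^i, N = 2^8 w the number of powers, m = D / 16 the
    tested mean and B its second moment. Close points have N |m| <= 1/64; far ones have N^2 m^2 =
    2^8 (D w)^2 >= 64. *)
Lemma level_arith (D B w Q : R) : 1 <= w -> 0 <= B -> B <= (1 + D ^+ 2) / 2 ^+ 8 -> 0 <= Q ->
  (D / 16) ^+ 2 * (2 ^+ 8 * w) ^+ 2 * Q <= 1 + B ->
  (`|D / 16| * (2 ^+ 8 * w) <= 1 -> (1 - `|D / 16| * (2 ^+ 8 * w)) ^+ 2 <= (1 + B) * Q) ->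
  (`|D| <= 1 / w / 2 ^+ 10 -> 16 / 17 <= Q) /\ (~~ (`|D| <= 1 / w / 2) -> Q <= 1 / 17).
Proof.
move=> w1 B0 hB Q0 up lo.
have w0 : 0 < w by lra.
have sqD : `|D| ^+ 2 = D ^+ 2 by rewrite real_normK ?num_real.
have nD : `|D / 16| = `|D| / 16 by rewrite normrM [`|16^-1|]ger0_norm //; lra.
rewrite nD in lo; have D0 := normr_ge0 D.
split.
- rewrite ler_pdivlMr; last lra.
  rewrite ler_pdivlMr // => hD.
  have u1 : `|D| / 16 * (2 ^+ 8 * w) <= 1 / 64 by lra.
  have u0 : 0 <= `|D| / 16 * (2 ^+ 8 * w) by rewrite !mulr_ge0 //; lra.
  have hD1 : `|D| <= 1 by nra.
  have hD2 : D ^+ 2 <= 1 by rewrite -sqD expr_le1.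
  have := lo (le_trans u1 _); move: (`|D| / 16 * (2 ^+ 8 * w)) u0 u1 => u u0 u1 {}lo.
  have {}lo : (1 - u) ^+ 2 <= (1 + B) * Q by apply: lo; lra.
  have h1 : 63 / 64 * (63 / 64) <= (1 - u) ^+ 2 by rewrite expr2; apply: ler_pM; lra.
  have h2 : B * Q <= 1 / 2 ^+ 7 * Q by rewrite ler_wpM2r //; lra.
  lra.
- rewrite -ltNge ltr_pdivrMr; last lra.
  rewrite ltr_pdivrMr // => hD.
  set T := (`|D| * w) ^+ 2.
  have hT : 1 / 4 <= T.
    have h1 : 1 / 2 <= `|D| * w by lra.
    have -> : 1 / 4 = (1 / 2) ^+ 2 :> R by field.
    by rewrite /T ler_sqr ?nnegrE //; lra.
  have hDT : D ^+ 2 <= T.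
    rewrite -sqD /T ler_sqr ?nnegrE ?mulr_ge0 ?(ltW w0) //.
    by rewrite ler_peMr.
  have up' : 2 ^+ 8 * (T * Q) <= 1 + B.
    apply: le_trans up; rewrite /T exprMn sqD le_eqVlt; apply/orP; left; apply/eqP; by field.
  rewrite leNgt; apply/negP => hQ.
  have h1 : T * (1 / 17) <= T * Q by rewrite ler_wpM2l ?ltW //; lra.
  lra.
Qed.

(** Dividing by 16 st, where st >= sigma, keeps the second moment of the tested variable at most (1
    + D^2) / 2^8. *)
Lemma level_test st s' i : 0 < st -> V <= st ^+ 2 ->
  exists2 q, 0 <= q <= 1 &
  [/\ `|mu - s'| <= st / 2 ^+ i / 2 ^+ 10 -> 16 / 17 <= q,
      ~~ (`|mu - s'| <= st / 2 ^+ i / 2) -> q <= 1 / 17 &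
      forall ka kr N, q * pr ka N + (1 - q) * pr kr N <=
        pr (CTest (fun x => (x - s') / (16 * st)) (i + 8) ka kr) (4 * 2 ^ (i + 8) + N)%N].
Proof.
move=> st0 hV.
have [q [q01 up lo hq]] := testP (fun x => (x - s') / (16 * st)) (i + 8).
exists q => //; move: up lo; set D := (mu - s') / st.
have -> : E (fun w => (y w - s') / (16 * st)) = D / 16.
  transitivity (E (fun w => (16 * st)^-1 * (y w + - s'))).
    by apply: eq_bigr => w _; rewrite [_^-1 * _]mulrC.
  by rewrite E_Z E_D E_cst /D; field; lra.
have hB : E (fun w => ((y w - s') / (16 * st)) ^+ 2) <= (1 + D ^+ 2) / 2 ^+ 8.
  have -> : E (fun w => ((y w - s') / (16 * st)) ^+ 2) = (V + (mu - s') ^+ 2) / (2 ^+ 8 * st ^+ 2).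
    rewrite -E_sq [RHS]mulrC -E_Z; by apply: eq_bigr => w _; field; lra.
  have -> : (1 + D ^+ 2) / 2 ^+ 8 = (st ^+ 2 + (mu - s') ^+ 2) / (2 ^+ 8 * st ^+ 2).
    by rewrite /D; field; lra.
  by rewrite ler_wpM2r ?lerD2r // invr_ge0 mulr_ge0 // exprn_ge0 // ltW.
have B0 : 0 <= E (fun w => ((y w - s') / (16 * st)) ^+ 2) by apply: E_ge0 => w; rewrite sqr_ge0.
move: (E (fun w => ((y w - s') / (16 * st)) ^+ 2)) hB B0 => B hB B0 up lo.
have w1 : 1 <= 2 ^+ i :> R by rewrite exprn_ege1 // ler1n.
have e2 : 2 ^+ (i + 8) = 2 ^+ 8 * 2 ^+ i :> R by rewrite exprD mulrC; ring.
have e4 : 4 ^+ (i + 8) = (2 ^+ 8 * 2 ^+ i) ^+ 2 :> R.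
  by rewrite -e2 -exprM mulnC exprM; congr (_ ^+ _); ring.
have nD : `|mu - s'| = `|D| * st.
  by rewrite /D normrM normfV (gtr0_norm st0) divfK // gt_eqF.
rewrite e4 in up; rewrite e2 in lo.
have cv b : (`|mu - s'| <= st / 2 ^+ i / b) = (`|D| <= 1 / 2 ^+ i / b).
  by rewrite nD -[RHS](ler_pM2r st0); congr (_ <= _); ring.
have /andP[q0 _] := q01.
by have [hg hb] := level_arith w1 B0 hB q0 up lo; split=> //; rewrite cv.
Qed.

(** Union bound for 16 votes: at most 2^12 points, failing with probability 2^-16 each. *)
Lemma grid_fail : (2 ^ 11).+1%:R * (1 / 2) ^+ 16 <= 1 / 16 :> R.
Proof.
have h : (2 ^ 11).+1%:R <= 2 ^+ 12 :> R by rewrite -natrX ler_nat ltn_exp2l.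
have h16 : 0 <= (1 / 2 : R) ^+ 16 by rewrite exprn_ge0 //; lra.
apply: le_trans (ler_wpM2r h16 h) _.
rewrite (exprD _ 12 4) mulrA -exprMn (_ : 2 * (1 / 2) = 1 :> R); last by field.
by rewrite expr1n mul1r !exprS expr0; lra.
Qed.

(** With [rem] levels left, the current one included, 16 + rem votes make it fail with probability
    at most 2^-rem / 16; summed over the levels, this is the subtracted term. *)
Lemma search_ok_aux rem i st s k c N : 0 < st -> V <= st ^+ 2 -> `|mu - s| <= st / 2 ^+ i ->
  0 <= c -> (forall s', `|mu - s'| <= st / 2 ^+ (i + rem) -> c <= pr (k s') N) ->
  c * (1 - 1 / 16 * (1 - (1 / 2) ^+ rem)) <= pr (search_prog rem i st s k) (search_cost rem i + N).
Proof.
move=> st0 hV + c0; elim: rem i s => [|rem ih] i s hs hk.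
  rewrite expr0 subrr mulr0 subr0 mulr1 add0n; apply: hk; by rewrite addn0.
rewrite search_progS.
have -> : (search_cost rem.+1 i + N = (2 ^ 11).+1 * ((16 + rem.+1) * (4 * 2 ^ (i + 8))) +
   (search_cost rem i.+1 + N))%N by rewrite addnA.
have f0 := pow_half_ge0 rem.
have f1 : (1 / 2 : R) ^+ rem <= 1 by rewrite exprn_ile1 //; lra.
set c' := c * (1 - 1 / 16 * (1 - (1 / 2) ^+ rem)).
have c'0 : 0 <= c' by rewrite mulr_ge0 //; lra.
have sz : size (grid s (st / 2 ^+ i)) = (2 ^ 11).+1 by rewrite size_map size_iota.
have := @scan_ok (fun s' x => (x - s') / (16 * st)) (i + 8) (16 + rem.+1)
  (grid s (st / 2 ^+ i)) (fun s' => search_prog rem i.+1 st s' k) (search_cost rem i.+1 + N) c'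
  (fun s' => `|mu - s'| <= st / 2 ^+ i / 2) (fun s' => `|mu - s'| <= st / 2 ^+ i / 2 ^+ 10) c'0
  (fun s' => level_test s' i st0 hV).
rewrite sz => h; apply: le_trans (h _ _ _) => {h}.
- rewrite exprD exprS mulrA; move: grid_fail.
  rewrite /c' exprS; move: c'0; rewrite /c'.
  move: ((1 / 2) ^+ rem) f0 f1 (_%:R * _) => f f0 f1 e c'0 e1.
  have h1 : 0 <= c * f by rewrite mulr_ge0.
  have h2 : 0 <= c * f * (1 - f) by rewrite mulr_ge0 // subr_ge0.
  have := ler_wpM2r f0 (ler_wpM2l c'0 e1); move=> h3; lra.
- move=> s' h; apply: le_trans h _.
  have : 0 < st / 2 ^+ i by rewrite divr_gt0 // exprn_gt0.
  by move=> ?; lra.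
- set r := st / 2 ^+ i in hs *; have r0 : 0 < r by rewrite divr_gt0 // exprn_gt0.
  have d0 : 0 < r / 2 ^+ 10 by lra.
  move: hs; rewrite ler_norml => /andP[hs1 hs2].
  (* The good grid point is the last one not above mu, found by rounding down. *)
  have t0 : 0 <= (mu - s + r) / (r / 2 ^+ 10) by rewrite divr_ge0 //; lra.
  have /andP[j1 j2] := truncn_itv t0; set j := Num.truncn _ in j1 j2.
  rewrite ler_pdivlMr // in j1; rewrite ltr_pdivrMr // -natr1 in j2.
  exists (s - r + j%:R * (r / 2 ^+ 10)).
    apply/mapP; exists j => //; rewrite mem_iota add0n leq0n /= -(ltr_nat R).
    rewrite -(ltr_pM2r d0); apply: le_lt_trans j1 _.
    have -> : (2 ^ 11).+1%:R = (2 ^+ 11 + 1) :> R by rewrite -natr1 natrX; ring.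
    by lra.
  by rewrite ler_norml; apply/andP; split; lra.
- move=> s' h; apply: ih.
    by move: h; rewrite exprS invfM mulrCA mulrC.
  by move=> s'' h'; apply: hk; rewrite addnS -addSn.
Qed.

Lemma search_ok rem st s k c N : 0 < st -> V <= st ^+ 2 -> `|mu - s| <= st / 2 ^+ 0 ->
  0 <= c -> (forall s', `|mu - s'| <= st / 2 ^+ (0 + rem) -> c <= pr (k s') N) ->
  15 / 16 * c <= pr (search_prog rem 0 st s k) (search_cost rem 0 + N).
Proof.
move=> st0 hV hs c0 hk; apply: le_trans (search_ok_aux st0 hV hs c0 hk).
by have f0 := pow_half_ge0 rem; rewrite [_ * c]mulrC ler_wpM2l //; lra.
Qed.

(** * Accuracy and cost of the stages of the whole program *)

Lemma mu_le1 : mu <= 1.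
Proof. by rewrite -(E_cst 1); apply: E_le => w; case/andP: (y01 w). Qed.

Lemma sqrX2 n : 4 ^+ n = (2 ^+ n) ^+ 2 :> R.
Proof. by rewrite -exprM mulnC exprM; congr (_ ^+ _); ring. Qed.

(** From u^2 q <= 2^8, st = 32 / u satisfies st^2 >= 4 q, which dominates V and (mu - s)^2. The 13
    in L is such that 2^13 (w a)^2 eps mu >= 32, the numerator of st. *)
Lemma final_stage eps j1 j3 s L (a := 2 ^+ j1 : R) (u := 2 ^+ j3 : R) (w := 2 ^+ digits eps : R)
    (q := (V + (mu - s) ^+ 2 + 1 / (w * a) ^+ 2) / 4) :
  0 < mu -> 0 < eps -> eps < 1 -> 1 / 2 ^+ 8 <= a ^+ 2 * mu -> 1 / 2 ^+ 8 <= u ^+ 2 * q <= 2 ^+ 8 ->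
  L = (2 * (digits eps + j1) + 13 - j3)%N ->
  [/\ V <= (32 / u) ^+ 2, `|mu - s| <= 32 / u & 32 / u / 2 ^+ L <= eps * mu].
Proof.
move=> mu0 e0 e1 ha /andP[_ hq] LE.
have /andP[he _] := digitsP e0 e1; rewrite sqrX2 -/w in he.
have a0 : 0 < a by rewrite exprn_gt0.
have w0 : 0 < w by rewrite exprn_gt0.
have u0 : 0 < u by rewrite exprn_gt0.
have V0 := V_ge0; have d0 := sqr_ge0 (mu - s).
have wa0 : 0 < 1 / (w * a) ^+ 2 by rewrite divr_gt0 // exprn_gt0 // mulr_gt0.
have u2 : 0 < u ^+ 2 by rewrite exprn_gt0.
have e2 : (32 / u) ^+ 2 = 2 ^+ 10 / u ^+ 2 by rewrite expr_div_n; congr (_ / _); ring.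
have hq4 : V + (mu - s) ^+ 2 + 1 / (w * a) ^+ 2 <= 2 ^+ 10 / u ^+ 2.
  by rewrite ler_pdivlMr //; move: hq; rewrite /q => hq; lra.
have st0 : 0 <= 32 / u by rewrite divr_ge0 // ltW.
split; first by rewrite e2; lra.
  rewrite -ler_sqr ?nnegrE ?normr_ge0 // e2 real_normK ?num_real //; lra.
(* Only an inequality, as the subtraction in L may be truncated. *)
have hL : 2 ^+ 13 * (w * a) ^+ 2 <= u * 2 ^+ L.
  have -> : 2 ^+ 13 * (w * a) ^+ 2 = 2 ^+ (2 * (digits eps + j1) + 13).
    by rewrite /w /a -exprD -exprM [RHS]exprD mulrC; congr (2 ^+ _ * _); rewrite mulnC.
  by rewrite /u -exprD ler_eXn2l ?ltr1n // LE -leq_subLR.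
have L0 : 0 < 2 ^+ L :> R by rewrite exprn_gt0.
have h1 : 1 / 2 ^+ 8 <= eps * mu * (w * a) ^+ 2.
  have -> : eps * mu * (w * a) ^+ 2 = (w ^+ 2 * eps) * (a ^+ 2 * mu) by ring.
  by rewrite -[1 / 2 ^+ 8]mul1r ler_pM //; lra.
have em0 : 0 < eps * mu by rewrite mulr_gt0.
rewrite -mulrA -invfM ler_pdivrMr ?mulr_gt0 //.
have := ler_wpM2l (ltW em0) hL.
have -> : (2 : R) ^+ 13 = 32 * 2 ^+ 8 by ring.
lra.
Qed.

(** With G = (w a)^2, 2^L = 2^13 G / u, while 1 / u^2 <= 2^8 q and 4 q <= V + 2 / G. Hence 4^L =
    O(G^2 V + G), which is O(X^2) because G = O(1 / (eps mu)). *)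
Lemma final_cost eps j1 j3 s X L (a := 2 ^+ j1 : R) (u := 2 ^+ j3 : R) (w := 2 ^+ digits eps : R)
    (q := (V + (mu - s) ^+ 2 + 1 / (w * a) ^+ 2) / 4) :
  0 < mu -> 0 < eps -> eps < 1 -> a ^+ 2 * mu <= 2 ^+ 8 -> 1 / 2 ^+ 8 <= u ^+ 2 * q ->
  (mu - s) ^+ 2 <= 1 / (w * a) ^+ 2 ->
  1 <= X -> 1 / (eps * mu) <= X ^+ 2 -> V / (eps * mu) ^+ 2 <= X ^+ 2 ->
  L = (2 * (digits eps + j1) + 13 - j3)%N ->
  2 ^+ L <= 2 ^+ 27 * X.
Proof.
move=> mu0 e0 e1 ha hq hs X1 XT XV LE.
have /andP[_ he] := digitsP e0 e1; rewrite sqrX2 -/w in he.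
(* In the truncated case L = 0, and X >= 1 suffices. *)
have [lej|ltj] := leqP (2 * (digits eps + j1) + 13) j3.
  have -> : L = 0%N by rewrite LE; apply/eqP; rewrite subn_eq0.
  have c1 : 1 <= 2 ^+ 27 :> R by rewrite exprn_ege1 // ler1n.
  have X0 : 0 <= X by lra.
  by rewrite expr0; apply: (le_trans X1); rewrite ler_peMl.
have a0 : 0 < a by rewrite exprn_gt0.
have w0 : 0 < w by rewrite exprn_gt0.
have u0 : 0 < u by rewrite exprn_gt0.
set G := (w * a) ^+ 2 in q hq hs *.
have G0 : 0 < G by rewrite exprn_gt0 // mulr_gt0.
have V0 := V_ge0.
have T0 : 0 < eps * mu by rewrite mulr_gt0.
have hL : u * 2 ^+ L = 2 ^+ 13 * G.
  have -> : 2 ^+ 13 * G = 2 ^+ (2 * (digits eps + j1) + 13).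
    by rewrite /G /w /a -exprD -exprM [RHS]exprD mulrC; congr (2 ^+ _ * _); rewrite mulnC.
  by rewrite /u -exprD LE subnKC // ltnW.
have hG : G <= 2 ^+ 10 * (1 / (eps * mu)).
  rewrite mulrA mulr1 ler_pdivlMr //.
  have -> : G * (eps * mu) = (w ^+ 2 * eps) * (a ^+ 2 * mu) by rewrite /G; ring.
  have -> : (2 ^+ 10 : R) = 4 * 2 ^+ 8 by ring.
  by rewrite ler_pM // mulr_ge0 // ltW // exprn_gt0.
have hGX : G <= 2 ^+ 10 * X ^+ 2 by lra.
have hGV : G ^+ 2 * V <= (2 ^+ 10 * X) ^+ 2.
  have h1 : G ^+ 2 <= (2 ^+ 10 * (1 / (eps * mu))) ^+ 2 
    by rewrite ler_sqr ?nnegrE ?(ltW G0) ?(le_trans (ltW G0) hG).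
  apply: le_trans (ler_wpM2r V0 h1) _.
  have -> : (2 ^+ 10 * (1 / (eps * mu))) ^+ 2 * V = 2 ^+ 10 ^+ 2 * (V / (eps * mu) ^+ 2).
    by field; rewrite !gt_eqF.
  by rewrite [(2 ^+ 10 * X) ^+ 2]exprMn ler_wpM2l // !exprn_ge0.
have hGq : G ^+ 2 * q <= (2 ^+ 10 * X) ^+ 2.
  have h1 : q <= (V + 2 * (1 / G)) / 4 by rewrite /q; lra.
  apply: le_trans (ler_wpM2l (exprn_ge0 2 (ltW G0)) h1) _.
  have -> : G ^+ 2 * ((V + 2 * (1 / G)) / 4) = (G ^+ 2 * V + 2 * G) / 4.
    by field; rewrite gt_eqF.
  have : 2 * G <= (2 ^+ 10 * X) ^+ 2.
    have -> : (2 ^+ 10 * X) ^+ 2 = 2 ^+ 10 * (2 ^+ 10 * X ^+ 2) by ring.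
    by lra.
  by move=> ?; lra.
have X0 : 0 <= X by lra.
have L0 : 0 <= 2 ^+ L :> R by rewrite exprn_ge0.
rewrite -ler_sqr ?nnegrE ?mulr_ge0 ?exprn_ge0 //.
have -> : (2 : R) ^+ 27 * X = 2 ^+ 13 * 16 * (2 ^+ 10 * X) by rewrite (exprD _ 13 14); ring.
rewrite -(ler_pM2l (exprn_gt0 2 u0)) -exprMn hL.
have hq' : 1 <= 2 ^+ 8 * (u ^+ 2 * q) by lra.
apply: (@le_trans _ _ ((2 ^+ 13 * G) ^+ 2 * (2 ^+ 8 * (u ^+ 2 * q)))).
  by rewrite ler_peMr // sqr_ge0.
have -> : (2 ^+ 13 * G) ^+ 2 * (2 ^+ 8 * (u ^+ 2 * q)) =
   u ^+ 2 * (((2 : R) ^+ 13 * 16) ^+ 2 * (G ^+ 2 * q)) by ring.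
have K0 : 0 < (2 : R) ^+ 13 * 16 by rewrite mulr_gt0 // exprn_gt0.
by rewrite ler_pM2l ?exprn_gt0 // [X in _ <= X]exprMn ler_pM2l // exprn_gt0.
Qed.

(** Here w^2 is of order 1 / eps and a^2 of order 1 / mu. Adding d = 1 / (w a)^2, of order eps mu,
    to (y - s)^2 keeps q away from 0, which bounds the cost of the loop by O(X). *)
Lemma refine_ok (search_const N3 N4 : nat) eps j1 s X (a := 2 ^+ j1 : R)
    (w := 2 ^+ digits eps : R) :
  (forall rem i, search_cost rem i <= search_const * 2 ^ (i + rem))%N ->
  0 < eps -> eps < 1 -> 0 < mu ->
  (forall r N, (1 - eps) * mu <= r <= (1 + eps) * mu -> pr (COut r) N = 1) ->
  1 <= X -> 1 / (eps * mu) <= X ^+ 2 -> V / (eps * mu) ^+ 2 <= X ^+ 2 ->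
  1 / 2 ^+ 8 <= a ^+ 2 * mu <= 2 ^+ 8 ->
  `|mu - s| <= 16 / a / (w * 2 ^+ 8) ->
  (forall n : nat, n%:R ^+ 2 <= (2 ^+ 13 * X) ^+ 2 -> (n <= N3)%N) ->
  (forall n : nat, n%:R ^+ 2 <= (search_const%:R * 2 ^+ 27 * X) ^+ 2 -> (n <= N4)%N) ->
  15 / 16 * (15 / 16 * 1) <=
    pr (loop_prog (fun x => ((x - s) ^+ 2 + 1 / 4 ^+ (digits eps + j1)) / 4) (fun j3 =>
      search_prog (2 * (digits eps + j1) + 13 - j3) 0 (32 / 2 ^+ j3) s (@COut R)) 0) (N3 + N4).
Proof.
move=> hcost e0 e1 mu0 hgood X1 XT XV /andP[j1l j1u] hs hN3 hN4.
have V0 := V_ge0.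
have X0 : 0 <= X by apply: le_trans X1.
have T0 : 0 < eps * mu by rewrite mulr_gt0.
have /andP[_ we2] := digitsP e0 e1; rewrite sqrX2 -/w in we2.
have w0 : 0 < w by rewrite exprn_gt0.
have w1 : 1 <= w by rewrite exprn_ege1 // ler1n.
have a0 : 0 < a by rewrite exprn_gt0.
have a1 : 1 <= a by rewrite exprn_ege1 // ler1n.
have hwa : 1 / 4 ^+ (digits eps + j1) = 1 / (w * a) ^+ 2 :> R.
  by rewrite sqrX2 exprD.
set d : R := 1 / 4 ^+ _ in hwa *.
have wa1 : 1 <= (w * a) ^+ 2 by rewrite exprn_ege1 // -[1]mulr1 ler_pM.
have wa0 : 0 < (w * a) ^+ 2 by apply: lt_le_trans wa1.
have d0 : 0 < d by rewrite hwa divr_gt0.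
have d1 : d <= 1 by rewrite hwa ler_pdivrMr // mul1r.
have hs2 : (mu - s) ^+ 2 <= 1 / 2 ^+ 8 * d.
  have -> : 1 / 2 ^+ 8 * d = (16 / a / (w * 2 ^+ 8)) ^+ 2.
    by rewrite hwa; field; rewrite !gt_eqF.
  rewrite -[(mu - s) ^+ 2]real_normK ?num_real // ler_sqr ?nnegrE //.
  by rewrite !divr_ge0 ?mulr_ge0 ?exprn_ge0 ?(ltW a0) ?(ltW w0).
have hs1 : `|mu - s| <= 1 / 16.
  rewrite -ler_sqr ?nnegrE ?divr_ge0 // real_normK ?num_real //.
  have -> : (1 / 16) ^+ 2 = 1 / 2 ^+ 8 :> R by field.
  by lra.
set q := E (fun x => ((y x - s) ^+ 2 + d) / 4).
have qE : q = (V + (mu - s) ^+ 2 + 1 / (w * a) ^+ 2) / 4.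
  rewrite -hwa -E_sq /q.
  transitivity (E (fun w => 4^-1 * ((y w - s) ^+ 2 + d))).
    by apply: eq_bigr => x _; rewrite [4^-1 * _]mulrC.
  by rewrite E_Z E_D E_cst mulrC.
have q0 : 0 < q.
  by rewrite qE -hwa; have d2 := sqr_ge0 (mu - s); lra.
(* As |y - s| <= 17/16 and d <= 1, the division by 4 brings the variable into [0, 1], as the loop
   requires. *)
have h01 x : 0 <= ((y x - s) ^+ 2 + d) / 4 <= 1.
  have ys : `|y x - s| <= 17 / 16.
    have -> : y x - s = (y x - mu) + (mu - s) by ring.
    apply: le_trans (ler_normD _ _) _.
    have ym : `|y x - mu| <= 1.
      have /andP[y0 y1] := y01 x; have m0 := ltW mu0; have m1 := mu_le1.
      by rewrite ler_norml; apply/andP; split; lra.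
    by lra.
  have ys2 : (y x - s) ^+ 2 <= (17 / 16) ^+ 2.
    by rewrite -real_normK ?num_real // ler_sqr ?nnegrE ?divr_ge0.
  have ys0 := sqr_ge0 (y x - s).
  by apply/andP; split; lra.
have q1 : q <= 1 by rewrite -(E_cst 1); apply: E_le => x; case/andP: (h01 x).
have [J3 hJ3] := scale_level q0 q1.
have G4 : (w * a) ^+ 2 <= 2 ^+ 10 * (1 / (eps * mu)).
  rewrite mulrA mulr1 ler_pdivlMr //.
  have -> : (w * a) ^+ 2 * (eps * mu) = (w ^+ 2 * eps) * (a ^+ 2 * mu) by ring.
  have -> : (2 ^+ 10 : R) = 4 * 2 ^+ 8 by ring.
  by rewrite ler_pM // mulr_ge0 // ltW // exprn_gt0.
have cost3 : (8 * 2 ^ J3 <= N3)%N.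
  apply: hN3; rewrite natrM natrX exprMn -sqrX2.
  have hd : d <= 4 * q by rewrite qE -hwa; have d2 := sqr_ge0 (mu - s); lra.
  have h2 : 4 ^+ J3 <= 2 ^+ 10 * (w * a) ^+ 2.
    have /andP[_ h3] := hJ3.
    have h4 := ler_wpM2l (exprn_ge0 J3 (ler0n R 4)) hd.
    have h5 : 4 ^+ J3 * d <= 2 ^+ 10.
      apply: le_trans h4 _; rewrite mulrCA (_ : 2 ^+ 10 = 4 * 2 ^+ 8 :> R) ?ler_wpM2l //; ring.
    by rewrite -ler_pdivrMr // -[_ / _]mulr1 -mulrA [_^-1 * 1]mulrC -/(1 / _) -hwa.
  have -> : (2 ^+ 13 * X) ^+ 2 = 8 ^+ 2 * (2 ^+ 10 * (2 ^+ 10 * X ^+ 2)).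
    by rewrite exprMn (exprD _ 3 10); ring.
  rewrite ler_wpM2l ?exprn_ge0 //.
  apply: le_trans h2 _; rewrite ler_wpM2l ?exprn_ge0 //.
  by apply: le_trans G4 _; rewrite ler_wpM2l ?exprn_ge0.
apply: le_trans (pr_le _ (leq_add cost3 (leqnn _))).
apply: (loop_ok (q := q)) => //; first by lra.
move=> j3; rewrite sqrX2 qE => hj3.
set L := (_ - _)%N.
have [fV fs fL] := final_stage (j1 := j1) (j3 := j3) (s := s) mu0 e0 e1 j1l hj3 (erefl L).
have /andP[hj3l _] := hj3.
have hs3 : (mu - s) ^+ 2 <= 1 / (w * a) ^+ 2.
  by rewrite -hwa; apply: le_trans hs2 _; rewrite ler_piMl ?(ltW d0) //
    ler_pdivrMr ?exprn_gt0 // mul1r exprn_ege1 // ler1n.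
have LX := final_cost mu0 e0 e1 j1u hj3l hs3 X1 XT XV (erefl L).
have cost4 : (search_cost L 0 <= N4)%N.
  apply: leq_trans (hcost _ _) _; apply: hN4.
  rewrite add0n natrM natrX ler_sqr ?nnegrE ?mulr_ge0 ?exprn_ge0 //.
  by rewrite -[X in _ <= X]mulrA ler_wpM2l.
apply: le_trans (pr_le _ (leq_trans _ cost4)); last exact: (leqnn (search_cost L 0)).
rewrite -[search_cost L 0]addn0.
have u0 : 0 < 32 / 2 ^+ j3 :> R by rewrite divr_gt0 // exprn_gt0.
apply: (search_ok u0 fV _ ler01).
- by rewrite expr0 divr1.
- move=> r; rewrite add0n => hr; rewrite hgood //.
  have := le_trans hr fL; rewrite ler_norml => /andP[l1 l2].
  by apply/andP; split; lra.
Qed.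

(** Each of the four stages keeps 15/16 of the success probability, and (15/16)^4 >= 2/3. The terms
    of the constant are the budgets of the stages: 1 / mu, 1 / eps and 1 / (eps mu) are at most X^2,
    and [final_cost] bounds the last stage. *)
Lemma mean_prog_ok (search_const : nat) eps :
  (forall rem i, search_cost rem i <= search_const * 2 ^ (i + rem))%N ->
  0 < eps -> 0 < mu ->
  (forall r N, (1 - eps) * mu <= r <= (1 + eps) * mu -> pr (COut r) N = 1) ->
  let X := Num.max (Num.sqrt V / (eps * mu)) (1 / Num.sqrt (eps * mu)) in
  exists N : nat, N%:R <= (2 ^+ 7 + search_const%:R * 2 ^+ 9 + 2 ^+ 13 +
      search_const%:R * 2 ^+ 27) * X /\ 2 / 3 <= pr (mean_prog eps) N.
Proof.
move=> hcost e0 mu0 hgood X.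
have T0 : 0 < eps * mu by rewrite mulr_gt0.
have V0 := V_ge0; have mu1 := mu_le1.
have s0 : 0 < 1 / Num.sqrt (eps * mu) by rewrite divr_gt0 // sqrtr_gt0.
have X0 : 0 <= X by rewrite /X le_max (ltW s0) orbT.
have [e1|e1] := leP 1 eps.
  (* For eps >= 1 the target interval contains 0, which is output without any query. *)
  exists 0%N; split; first by rewrite !mulr_ge0 ?addr_ge0 ?mulr_ge0 ?exprn_ge0.
  rewrite /mean_prog e1 hgood; first lra.
  by apply/andP; split; nra.
have XT : 1 / (eps * mu) <= X ^+ 2.
  have -> : 1 / (eps * mu) = (1 / Num.sqrt (eps * mu)) ^+ 2.
    by rewrite expr_div_n expr1n sqr_sqrtr // ltW.
  by rewrite ler_sqr ?nnegrE ?(ltW s0) // /X le_max lexx orbT.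
have XV : V / (eps * mu) ^+ 2 <= X ^+ 2.
  have -> : V / (eps * mu) ^+ 2 = (Num.sqrt V / (eps * mu)) ^+ 2.
    by rewrite expr_div_n sqr_sqrtr.
  by rewrite ler_sqr ?nnegrE ?divr_ge0 ?sqrtr_ge0 ?(ltW T0) // /X le_max lexx.
have X1 : 1 <= X.
  rewrite -(@ler_pXn2r _ 2) ?nnegrE // expr1n; apply: le_trans XT.
  by rewrite ler_pdivlMr // mul1r mulr_ile1 // ltW.
have bound (n : nat) K : 0 <= K -> n%:R ^+ 2 <= (K * X) ^+ 2 -> (n <= Num.truncn (K * X))%N.
  by move=> K0; rewrite ler_sqr ?nnegrE ?mulr_ge0 // => h; rewrite truncn_ge_nat ?mulr_ge0.
have /andP[we1 we2] := digitsP e0 e1; rewrite sqrX2 in we1 we2.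
set w : R := 2 ^+ digits eps in we1 we2.
have w0 : 0 < w by rewrite exprn_gt0.
have w1 : 1 <= w by rewrite exprn_ege1 // ler1n.
have iemu : 1 / mu <= 1 / (eps * mu).
  rewrite ler_pdivrMr // mulrAC mul1r.
  have -> : mu / (eps * mu) = 1 / eps by field; rewrite !gt_eqF.
  by rewrite ler_pdivlMr // mul1r ltW.
have ieps : 1 / eps <= 1 / (eps * mu).
  rewrite ler_pdivrMr // mulrAC mul1r.
  have -> : eps / (eps * mu) = 1 / mu by field; rewrite !gt_eqF.
  by rewrite ler_pdivlMr // mul1r.
set K1 : R := 2 ^+ 7; set K2 : R := search_const%:R * 2 ^+ 9; set K3 : R := 2 ^+ 13.
set K4 : R := search_const%:R * 2 ^+ 27.
have K10 : 0 <= K1 by rewrite exprn_ge0. have K20 : 0 <= K2 by rewrite mulr_ge0 // exprn_ge0.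
have K30 : 0 <= K3 by rewrite exprn_ge0. have K40 : 0 <= K4 by rewrite mulr_ge0 // exprn_ge0.
set N1 := Num.truncn (K1 * X); set N2 := Num.truncn (K2 * X).
set N3 := Num.truncn (K3 * X); set N4 := Num.truncn (K4 * X).
exists (N1 + (N2 + (N3 + N4)))%N; split.
  have t K : 0 <= K -> (Num.truncn (K * X))%:R <= K * X by move=> K0; rewrite truncn_le mulr_ge0.
  have := t _ K10; have := t _ K20; have := t _ K30; have := t _ K40.
  by rewrite -/N1 -/N2 -/N3 -/N4 !natrD => *; lra.
have [J1 hJ1] := scale_level mu0 mu1.
have cost1 : (8 * 2 ^ J1 <= N1)%N.
  apply: bound => //; rewrite natrM natrX exprMn -sqrX2.
  have h1 : 4 ^+ J1 <= 2 ^+ 8 * (1 / mu) by rewrite mulrA mulr1 ler_pdivlMr //; case/andP: hJ1.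
  rewrite /K1 [(2 ^+ 7 * X) ^+ 2]exprMn; lra.
rewrite /mean_prog (lt_geF e1) -/w.
apply: le_trans (pr_le _ (leq_add cost1 (leqnn _))).
have h1 : 2 / 3 <= 15 / 16 * (15 / 16 * (15 / 16 * (15 / 16 * 1))) :> R by lra.
apply: le_trans h1 _.
apply: (loop_ok (q := mu)) => //; first lra.
move=> j1 /andP[j1l j1u]; rewrite sqrX2 in j1l j1u.
set a : R := 2 ^+ j1 in j1l j1u *.
have a0 : 0 < a by rewrite exprn_gt0.
have a1 : 1 <= a by rewrite exprn_ege1 // ler1n.
have cost2 : (search_cost (digits eps + 8) 0 <= N2)%N.
  apply: leq_trans (hcost _ _) _; apply: bound => //.
  rewrite add0n natrM natrX exprD -/w /K2.
  have h2 : w ^+ 2 <= (2 * X) ^+ 2.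
    have : w ^+ 2 <= 4 * (1 / eps) by rewrite mulrA mulr1 ler_pdivlMr.
    by rewrite exprMn => ?; lra.
  have h3 : w <= 2 * X by rewrite -ler_sqr ?nnegrE ?mulr_ge0 // ltW.
  rewrite ler_sqr ?nnegrE ?mulr_ge0 ?exprn_ge0 ?(ltW w0) //.
  rewrite -[X in _ <= X]mulrA ler_wpM2l //.
  have -> : 2 ^+ 9 * X = 2 * X * 2 ^+ 8 by rewrite exprS; ring.
  by rewrite ler_wpM2r // exprn_ge0.
apply: le_trans (pr_le _ (leq_add cost2 (leqnn _))).
have e16 : (16 : R) ^+ 2 = 2 ^+ 8 by ring.
(* Since a^2 mu <= 2^8 and mu <= 1, 16 / a bounds both sigma and mu, so the search can start at
   0. *)
have V1 : V <= (16 / a) ^+ 2.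
  apply: le_trans V_le_mu _; rewrite expr_div_n ler_pdivlMr ?exprn_gt0 //.
  by rewrite mulrC e16.
have st1 : 0 < 16 / a by rewrite divr_gt0.
have mus : `|mu - 0| <= 16 / a / 2 ^+ 0.
  rewrite subr0 gtr0_norm // expr0 divr1 -ler_sqr ?nnegrE ?(ltW mu0) ?(ltW st1) //.
  apply: (@le_trans _ _ mu); first by rewrite expr2 ler_piMl // ltW.
  rewrite expr_div_n ler_pdivlMr ?exprn_gt0 //.
  by rewrite mulrC e16.
set c3 : R := 15 / 16 * (15 / 16 * 1).
have c30 : 0 <= c3 by rewrite /c3 !mulr_ge0 ?invr_ge0.
apply: (search_ok st1 V1 mus c30) => s; rewrite add0n exprD -/w => hs.
apply: (refine_ok (X := X)) => //.
- by rewrite j1l.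
- by move=> n; apply: bound.
- by move=> n; apply: bound.
Qed.

End Programs.

(** * The quantum algorithm *)

Section Algorithm.
Variables (R : realType) (a g b c : nat).
Local Notation C := R[i].
Local Notation w1 := (2 ^ b * 2 ^ c * 1)%N.

(* An algorithm must be well formed for every init; those that are not unit
   vectors are replaced by a basis state. *)
Definition unit_init (init : 'cV[C]_(2 ^ a * 2 ^ g)) : 'cV[C]_(2 ^ a * 2 ^ g) :=
  if sqnorm init == 1 then init else ket R (mxtens_index (zero_bits a, zero_bits g)).

Lemma unit_init1 init : sqnorm (unit_init init) = 1.
Proof. by rewrite /unit_init; case: eqP => // _; exact: sqnorm_ket. Qed.

Variables (init : 'cV[C]_(2 ^ a * 2 ^ g)) (val_dec : 'I_(2 ^ b) -> R).

Definition ready : 'cV[C]_(box_dim (2 ^ a * 2 ^ g) (2 ^ a * 2 ^ b * 2 ^ c) BoxP * w1) :=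
  box_embed R (2 ^ a) (2 ^ g) (2 ^ b) (2 ^ c) 1 BoxP w1 *m
    start (unit_init init) (zero_bits b) (zero_bits c).

Lemma ready1 : sqnorm ready = 1.
Proof. by rewrite (sqnorm_iso _ (isometry_box_embed _ _ _ _ _ _ _ _)) start1 // unit_init1. Qed.

Definition test_block h J ka kr :=
  test_body (zero_bits b) (zero_bits c) val_dec (unit_init1 init) ready1 h J ka kr.

Definition mean_algorithm (eps : R) : process R (2 ^ a * 2 ^ g) (2 ^ a * 2 ^ b * 2 ^ c) 1 :=
  compile ready1 test_block (mean_prog eps).

End Algorithm.

Lemma test_cost_le J : ((test_cost J).+1 <= 4 * 2 ^ J)%N.
Proof.
suff : (test_cost J + 4 = 4 * 2 ^ J)%N by lia.
by elim: J => //= J ih; rewrite expnS; lia.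
Qed.

(** The acceptance probability is |B psi|^2 for the average B of the walk; the relation U v = v + 2
    i m psi gives its bounds, with |v|^2 = 1 + E[z^2]. *)
Lemma test_spec_walk (R : realType) (Omega : finType) (p y : Omega -> R) (a g b c : nat)
    (enc : Omega -> 'I_(2 ^ a)) (val_enc : R -> 'I_(2 ^ b)) (val_dec : 'I_(2 ^ b) -> R)
    (init : 'cV[R[i]]_(2 ^ a * 2 ^ g)) P Y good h J :
  is_distr p -> injective enc -> (forall w, val_dec (val_enc (y w)) = y w) ->
  sqnorm init = 1 -> synthesizer p enc init P -> evaluator (c := c) y enc val_enc Y ->
  exists q, test_spec p y (pr (ready b c init) (test_block c init val_dec) P Y good) h J q.
Proof.
move=> [p01 p1] inj dec i1 [/unitary_isometry hP [garbage [g1 Pinit]]] [/unitary_isometry hY Yenc].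
have p0 w : 0 <= p w by case/andP: (p01 w).
have ui : unit_init init = init by rewrite /unit_init i1 eqxx.
have Pui : P *m unit_init init = P *m init by rewrite ui.
rewrite -Pui in Pinit.
have hU := walk_isometry (zero_bits b) (zero_bits c) val_dec (unit_init1 init) hP hY h.
have hv := walk_eigvec p0 p1 inj dec g1 hP hY Pinit Yenc h.
have rv := rdot_eigvec (zero_bits b) (zero_bits c) y p0 p1 inj g1 Pinit h.
have nv := sqnorm_eigvec (zero_bits b) (zero_bits c) y p0 p1 inj g1 h.
have npsi : sqnorm (synth_state (unit_init init) (zero_bits b) (zero_bits c) P) = 1.
  by rewrite (sqnorm_iso _ (lift_isometry _ hP)) start1 // unit_init1.
have up := avg_upper hU hv J; have lo := avg_lower hU npsi hv rv (J := J).
rewrite nv in up lo.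
exists (sqnorm (avg (walk (unit_init init) (zero_bits b) (zero_bits c) val_dec P Y h) J *m
  synth_state (unit_init init) (zero_bits b) (zero_bits c) P)).
split=> //.
  by rewrite sqnorm_ge0 /= -[X in _ <= X]npsi avg_le.
move=> ka kr N.
apply: le_trans (pr_CTest good hP hY (erefl _) (fun _ _ _ _ => erefl _) h J ka kr N) _.
by apply: pr_le; [exact: ready1|rewrite -addSn leq_add2r test_cost_le].
Qed.

Theorem theorem1p4 (R : realType) :
  exists (K : R) (alg : algorithm R),
  forall (eps : R) (Omega : finType) (p y : Omega -> R)
    (a g b c : nat)
    (enc : Omega -> 'I_(2 ^ a))
    (val_enc : R -> 'I_(2 ^ b)) (val_dec : 'I_(2 ^ b) -> R)
    (init : 'cV[R[i]]_(2 ^ a * 2 ^ g))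
    (P : 'M[R[i]]_(2 ^ a * 2 ^ g))
    (Y : 'M[R[i]]_(2 ^ a * 2 ^ b * 2 ^ c)),
  let mu := expectation p y in
  let sigma := stddev p y in
  0 < eps ->
  is_distr p ->
  (forall w, 0 <= y w <= 1) ->
  0 < mu ->
  injective enc ->
  (forall w, val_dec (val_enc (y w)) = y w) ->
  sqnorm init = 1 ->
  synthesizer p enc init P ->
  evaluator y enc val_enc Y ->
  exists N : nat,
    N%:R <= K * Num.max (sigma / (eps * mu)) (1 / Num.sqrt (eps * mu)) /\
    1 - prob P Y (fun r => (1 - eps) * mu <= r <= (1 + eps) * mu) N
          (alg eps a g b c init val_dec) (const_mx 1) <= 1 / 3.
Proof.
have [k hk] := scan_cost_le (2 ^ 11).+1.
exists (2 ^+ 7 + k%:R * 2 ^+ 9 + 2 ^+ 13 + k%:R * 2 ^+ 27).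
exists (fun eps a g b c init val_dec => @mean_algorithm R a g b c init val_dec eps).
move=> eps Omega p y a g b c enc val_enc val_dec init P Y mu sigma.
move=> eps0 hp y01 mu0 inj dec init1 hP hY.
have [p01 p1] := hp; have p0 w : 0 <= p w by case/andP: (p01 w).
set good : pred R := fun r => _.
have rdy1 := @ready1 R a g b c init.
have [N [hN hpc]] := mean_prog_ok p0 p1 y01
  (fun cp N => pr_ge0 rdy1 (test_block c init val_dec) P Y good cp N)
  (fun cp N N' => pr_le rdy1 (test_block c init val_dec) P Y good cp (N := N) (N' := N'))
  (fun h J => test_spec_walk good h J hp inj dec init1 hP hY) hk eps0 mu0
  (fun r N hr => pr_COut rdy1 (test_block c init val_dec) P Y (good := good) N hr).
exists N; split; first exact: hN.
rewrite /mean_algorithm prob_compile; move: hpc; move: (pr _ _ _ _ _ _ _) => x hx; lra.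
Qed.
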